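(* Let $K=\mathbb Z/2\mathbb Z$, let $\kappa$ be the uniform probability measure on $K$, and let $\mathbb F_2=\langle a,b\rangle$ be the free group of rank 2. Let $\mathbb F_2/\langle b\rangle$ be the set of left cosets of $\langle b\rangle$. Then the shift action $\mathbb F_2\curvearrowright\big(K^{\mathbb F_2/\langle b\rangle},\kappa^{\mathbb F_2/\langle b\rangle}\big)$, defined by $(g\cdot x)(C)=x(g^{-1}C)$ for $g\in\mathbb F_2$, $x\in K^{\mathbb F_2/\langle b\rangle}$, $C\in\mathbb F_2/\langle b\rangle$, is stably orbit equivalent to a nontrivial Bernoulli shift over the free group $\mathbb F_3$ of rank 3.
   Context: $\kappa^{\mathbb F_2/\langle b\rangle}$ is the product measure. For a countable group $G$ and a standard probability space $(L,\lambda)$, the Bernoulli shift over $G$ with base space $(L,\lambda)$ is the action $G\curvearrowright(L^G,\lambda^G)$, $(g\cdot x)(h)=x(g^{-1}h)$, with $\lambda^G$ the product measure. It is nontrivial if $\lambda$ is not supported on a single point. Stable orbit equivalence: two p.m.p. actions $G_1\curvearrowright^T(X_1,\mu_1)$, $G_2\curvearrowright^S(X_2,\mu_2)$ of countable groups on standard probability spaces are stably orbit equivalent if there exist positive measure sets $A_i\subset X_i$ and a map $\phi:A_1\to A_2$ inducing a measure-space isomorphism (mod null sets) between $(A_1,\mu_1(\cdot|A_1))$ and $(A_2,\mu_2(\cdot|A_2))$ such that for a.e. $x\in A_1$, $\phi(\{T_gx:g\in G_1\}\cap A_1)=\{S_g\phi(x):g\in G_2\}\cap A_2$ (up to discarding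 null sets). Here $\mu(E|A)=\mu(E\cap A)/\mu(A)$. *)

(* Defs.v *)
From HB Require Import structures.
From mathcomp Require Import all_boot all_order all_algebra finmap.
From mathcomp Require Import all_classical all_reals all_analysis.

Set Implicit Arguments.
Unset Strict Implicit.
Unset Printing Implicit Defensive.

Import Order.TTheory GRing.Theory Num.Theory.
Local Open Scope classical_set_scope.
Local Open Scope ring_scope.

Section FreeGroup.
Variable n : nat.

(* (i, false) stands for the generator of index i, (i, true) for its inverse. *)
Definition letter := ('I_n * bool)%type.

Definition letter_inv (l : letter) : letter := (l.1, ~~ l.2).

Definition reduced : pred (seq letter) :=
  sorted (fun l m => m != letter_inv l).

Definition push (l : letter) (w : seq letter) : seq letter :=
  if w is m :: w' then if m == letter_inv l then w' else l :: w else [:: l].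

Lemma letter_invK : involutive letter_inv.
Proof. by case=> i b; rewrite /letter_inv /= negbK. Qed.

Lemma reduced_behead l w : reduced (l :: w) -> reduced w.
Proof. by case: w => //= m w /andP[]. Qed.

Lemma push_reduced l w : reduced w -> reduced (push l w).
Proof.
case: w => //= m w rw; case: ifPn => [_|ml]; first exact: reduced_behead rw.
by rewrite /reduced /= ml.
Qed.

Lemma foldr_push_reduced v w : reduced w -> reduced (foldr push w v).
Proof. by move=> rw; elim: v => //= l v; exact: push_reduced. Qed.

Lemma pushK l w : reduced w -> push (letter_inv l) (push l w) = w.
Proof.
case: w => [|m w] /=; first by rewrite letter_invK eqxx.
case: ifPn => [/eqP->|_ _]; last by rewrite /= letter_invK eqxx.
case: w => //= k w; rewrite /reduced /= => /andP[kl _].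
by rewrite (negbTE kl).
Qed.

Lemma pushVK l w : reduced w -> push l (push (letter_inv l) w) = w.
Proof. by move=> rw; rewrite -{1}(letter_invK l) pushK. Qed.

Lemma foldr_push_id w : reduced w -> foldr push [::] w = w.
Proof.
elim: w => //= l w IH rw; rewrite IH; last exact: reduced_behead rw.
by case: w rw {IH} => //= m w; rewrite /reduced /= => /andP[/negbTE->].
Qed.

Lemma foldr_push_push l v w : reduced w ->
  foldr push w (push l v) = push l (foldr push w v).
Proof.
case: v => //= m v rw; case: ifPn => //= /eqP->.
by rewrite pushVK // foldr_push_reduced.
Qed.

Lemma foldr_pushA u v w : reduced w ->
  foldr push w (foldr push v u) = foldr push (foldr push w v) u.
Proof. by move=> rw; elim: u => //= l u <-; rewrite foldr_push_push. Qed.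

Definition word_inv (w : seq letter) : seq letter := rev (map letter_inv w).

Lemma word_inv_reduced w : reduced w -> reduced (word_inv w).
Proof.
rewrite /reduced /word_inv rev_sorted sorted_map.
apply: sub_sorted => l m /=; apply: contra_neq.
by rewrite letter_invK => ->.
Qed.

Lemma foldr_push_invl w v : reduced v ->
  foldr push (foldr push v w) (word_inv w) = v.
Proof.
move=> rv; elim: w => [|l w IH] //=.
by rewrite /word_inv map_cons rev_cons foldr_rcons pushK ?foldr_push_reduced.
Qed.

Lemma word_invK : involutive word_inv.
Proof. by move=> w; rewrite /word_inv map_rev revK mapK //; exact: letter_invK. Qed.

Record free_group := FreeGroup { fg_word :> seq letter; _ : reduced fg_word }.

HB.instance Definition _ := [isSub for fg_word].
HB.instance Definition _ := [Countable of free_group by <:].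

Implicit Types x y z : free_group.

Definition fg_one : free_group := @FreeGroup [::] isT.
Definition fg_mul x y : free_group :=
  FreeGroup (foldr_push_reduced x (valP y)).
Definition fg_inv x : free_group := FreeGroup (word_inv_reduced (valP x)).

Lemma fg_mulA : associative fg_mul.
Proof. by move=> x y z; apply/val_inj; rewrite /= foldr_pushA // (valP z). Qed.

Lemma fg_mul1 : left_id fg_one fg_mul.
Proof. by move=> x; exact/val_inj. Qed.

Lemma fg_mulr1 : right_id fg_one fg_mul.
Proof. by move=> x; apply/val_inj; rewrite /= foldr_push_id // (valP x). Qed.

Lemma fg_mulV : left_inverse fg_one fg_inv fg_mul.
Proof.
move=> x; apply/val_inj => /=.
by have := @foldr_push_invl x [::] isT; rewrite foldr_push_id // (valP x).
Qed.

Lemma fg_mulrV : right_inverse fg_one fg_inv fg_mul.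
Proof.
move=> x; have : fg_inv (fg_inv x) = x by apply/val_inj; rewrite /= word_invK.
by move=> {1}<-; rewrite fg_mulV.
Qed.

HB.instance Definition _ := isGroup.Build free_group
  fg_mulA fg_mul1 fg_mulr1 fg_mulV fg_mulrV.

Definition fg_gen (i : 'I_n) : free_group := @FreeGroup [:: (i, false)] isT.

End FreeGroup.

Section Cosets.
Local Open Scope group_scope.
Variable G : groupType.

Definition cyclic_subgroup (b : G) : set G :=
  [set g | exists k : nat, g = b ^+ k \/ g = b ^- k].

Definition left_translate (g : G) (A : set G) : set G := [set g * a | a in A].

Definition left_cosets (H : set G) : set (set G) :=
  range (fun g => left_translate g H).

Lemma left_translate1 A : left_translate 1 A = A.
Proof.
apply/seteqP; split=> [_ [a Aa <-]|a Aa]; first by rewrite mul1g.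
by exists a; rewrite ?mul1g.
Qed.

Lemma left_translateM g h A :
  left_translate (g * h) A = left_translate g (left_translate h A).
Proof.
apply/seteqP; split=> [_ [a Aa <-]|_ [_ [a Aa <-] <-]].
  by exists (h * a); [exists a|rewrite mulgA].
by exists a => //; rewrite mulgA.
Qed.

Lemma left_translate_coset H g (C : left_cosets H) :
  left_translate g (val C) \in left_cosets H.
Proof.
have [h _ <-] := set_mem (valP C).
by apply/mem_set; exists (g * h) => //; rewrite left_translateM.
Qed.

Definition coset_translate H (g : G) (C : left_cosets H) : left_cosets H :=
  SigSub (left_translate_coset g C).

Lemma coset_translate1 H (C : left_cosets H) : coset_translate 1 C = C.
Proof. by apply/val_inj; rewrite /= left_translate1. Qed.

Lemma coset_translateM H g h (C : left_cosets H) :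
  coset_translate (g * h) C = coset_translate g (coset_translate h C).
Proof. by apply/val_inj; rewrite /= left_translateM. Qed.

End Cosets.

Section ProductSpace.
Context (I : choiceType) d (T : measurableType d) (R : realType).

Definition coordinate_sets : set (set (I -> T)) :=
  [set [set x | A (x i)] | i in [set: I] & A in measurable].

Definition product_space : measurableType (sigma_display coordinate_sets) :=
  g_sigma_algebraType coordinate_sets.

Definition cylinder (J : {fset I}) (A : I -> set T) : set product_space :=
  [set x | forall i, i \in J -> A i (x i)].

(* mu is the product measure lam^I; it is unique by product_measure_unique. *)
Definition is_product_measure (lam : probability T R)
    (mu : {measure set product_space -> \bar R}) : Prop :=
  forall (J : {fset I}) (A : I -> set T), (forall i, measurable (A i)) ->
    mu (cylinder J A) = (\prod_(i <- J) lam (A i))%E.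

Let cylinders : set (set product_space) :=
  [set C | exists (J : {fset I}) (A : I -> set T),
    (forall i, measurable (A i)) /\ C = cylinder J A].

Lemma measurable_cylinder J A : (forall i, measurable (A i)) ->
  measurable (cylinder J A).
Proof.
move=> mA; rewrite (_ : cylinder J A =
    \bigcap_(i in [set` J]) ((fun x : product_space => x i) @^-1` A i)).
  apply: fin_bigcap_measurable => // i _; apply: sub_sigma_algebra.
  by exists i => //; exists (A i).
by apply/seteqP; split.
Qed.

Let cylinders_gen : @measurable _ product_space = <<s cylinders >>.
Proof.
apply/seteqP; split.
  apply: smallest_sub; first exact: smallest_sigma_algebra.
  move=> _ [i _ [A mA <-]]; apply: sub_sigma_algebra.
  exists [fset i]%fset, (fun=> A); split => //.
  apply/seteqP; split => [x Ax j|x]; first by rewrite inE => /eqP->.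
  by apply; rewrite inE.
apply: smallest_sub; first exact: sigma_algebra_measurable.
by move=> _ [J [A [mA ->]]]; exact: measurable_cylinder.
Qed.

Let cylindersI : setI_closed cylinders.
Proof.
move=> _ _ [J [A [mA ->]]] [J' [A' [mA' ->]]].
exists (J `|` J')%fset, (fun i => (if i \in J then A i else setT) `&`
                                  (if i \in J' then A' i else setT)).
split.
  by move=> i; apply: measurableI; case: ifP => // _; exact: measurableT.
apply/seteqP; split => [x [xA xA'] i _|x xAA'].
  by split; case: ifPn => // iJ; [exact: xA|exact: xA'].
by split => i iJ; have := xAA' i; rewrite in_fsetU iJ ?orbT => /(_ isT)[].
Qed.

Lemma product_measure_unique lam (mu nu : {measure set product_space -> \bar R}) :
  is_product_measure lam mu -> is_product_measure lam nu ->
  forall A, measurable A -> mu A = nu A.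
Proof.
move=> mup nup; have setTE : cylinder fset0 (fun=> setT) = setT.
  by apply/seteqP; split.
apply: (measure_unique cylinders (fun=> setT)) => //.
- by move=> _; exists fset0, (fun=> setT); split=> // i; exact: measurableT.
- by rewrite bigcup_const //; exists 0%N.
- by move=> _ [J [A [mA ->]]]; rewrite mup // nup.
- move=> _; rewrite -setTE mup; last by move=> i; exact: measurableT.
  by rewrite big_seq_fset0 ltry.
Qed.

End ProductSpace.

Record pmp_action (G : groupType) d (X : measurableType d) (R : realType)
    (mu : probability X R) := PmpAction {
  pmp_act :> G -> X -> X;
  pmp_act1 : forall x, pmp_act 1%g x = x;
  pmp_actM : forall g h x, pmp_act (g * h)%g x = pmp_act g (pmp_act h x);
  pmp_act_measurable : forall g, measurable_fun setT (pmp_act g);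
  pmp_act_preserving : forall g A, measurable A -> mu (pmp_act g @^-1` A) = mu A
}.

Definition act_orbit G d (X : measurableType d) (R : realType)
    (mu : probability X R) (T : pmp_action G mu) (x : X) : set X :=
  range (fun g => T g x).

Section Shift.
Context (G : groupType) (I : choiceType) (tau : G -> I -> I).
Hypothesis tau1 : forall i, tau 1%g i = i.
Hypothesis tauM : forall g h i, tau (g * h)%g i = tau g (tau h i).
Context d (T : measurableType d) (R : realType) (lam : probability T R).
Variable mu : probability (product_space I T) R.
Hypothesis mu_product : is_product_measure lam mu.

Definition shift (g : G) (x : product_space I T) : product_space I T :=
  fun i => x (tau g^-1%g i).

Lemma shift1 x : shift 1%g x = x.
Proof. by apply/funext => i; rewrite /shift invg1 tau1. Qed.

Lemma shiftM g h x : shift (g * h)%g x = shift g (shift h x).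
Proof. by apply/funext => i; rewrite /shift invgM tauM. Qed.

Lemma shift_measurable g : measurable_fun setT (shift g).
Proof.
apply: (@measurability _ _ (product_space I T) (product_space I T) setT
  (shift g) (@coordinate_sets I d T) erefl).
move=> _ [_ [i _ [A mA <-]] <-]; rewrite setTI; apply: sub_sigma_algebra.
by exists (tau g^-1%g i) => //; exists A.
Qed.

Lemma shift_preserving g A : measurable A -> mu (shift g @^-1` A) = mu A.
Proof.
move=> mA; have tauK : cancel (tau g) (tau g^-1%g).
  by move=> i; rewrite -tauM mulVg tau1.
have tauVK : cancel (tau g^-1%g) (tau g).
  by move=> i; rewrite -tauM mulgV tau1.
pose shift_mfun : {mfun product_space I T >-> product_space I T} :=
  HB.pack (shift g) (isMeasurableFun.Build _ _ _ _ _ (shift_measurable g)).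
apply: (@product_measure_unique _ _ _ _ lam (distribution mu shift_mfun) mu)
  => // J B mB.
transitivity (mu (cylinder (tau g^-1%g @` J)%fset (B \o tau g))); last first.
  rewrite mu_product; last by move=> i; exact: mB.
  rewrite big_imfset /=; last by move=> i j _ _; exact: (can_inj tauVK).
  by apply: eq_bigr => i _; rewrite tauVK.
rewrite /distribution /pushforward; congr (mu _).
apply/seteqP; split => x xJ i.
  by move=> /imfsetP[j /= jJ ->]; rewrite /= tauVK; exact: xJ.
move=> iJ; have := xJ (tau g^-1%g i); rewrite /= tauVK; apply.
by apply/imfsetP; exists i.
Qed.

Definition shift_action : pmp_action G mu :=
  PmpAction shift1 shiftM shift_measurable shift_preserving.

End Shift.

(* (g . x)(h) = x(g^-1 h) *)
Definition bernoulli_shift (G : groupType) d (L : measurableType d)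
    (R : realType) (lam : probability L R)
    (mu : probability (product_space G L) R)
    (mu_product : is_product_measure lam mu) : pmp_action G mu :=
  shift_action (@mul1g G) (fun g h i => esym (mulgA g h i)) mu_product.

(* (g . x)(C) = x(g^-1 C) *)
Definition coset_shift (G : groupType) (H : set G) d (K : measurableType d)
    (R : realType) (kap : probability K R)
    (mu : probability (product_space (left_cosets H) K) R)
    (mu_product : is_product_measure kap mu) : pmp_action G mu :=
  shift_action (@coset_translate1 G H) (@coset_translateM G H) mu_product.

Section StableOrbitEquivalence.
Context (R : realType) (G1 G2 : groupType).
Context d1 (X1 : measurableType d1) (mu1 : probability X1 R).
Context d2 (X2 : measurableType d2) (mu2 : probability X2 R).

Definition conditional d (X : measurableType d) (mu : probability X R)
    (A E : set X) : \bar R := (mu (E `&` A) * ((fine (mu A))^-1)%:E)%E.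

Definition conull_in d (X : measurableType d) (mu : probability X R)
    (A B : set X) : Prop := [/\ measurable B, B `<=` A & mu (A `\` B) = 0%E].

(* phi restricts to an isomorphism of measurable spaces from B1 to B2 carrying
   mu1( . | A1) to mu2( . | A2). *)
Definition measure_iso_on (A1 B1 : set X1) (A2 B2 : set X2) (phi : X1 -> X2) :
    Prop :=
  [/\ set_bij B1 B2 phi,
      forall E, measurable E -> E `<=` B2 -> measurable (B1 `&` phi @^-1` E),
      forall E, measurable E -> E `<=` B1 -> measurable (phi @` E) &
      forall E, measurable E -> E `<=` B2 ->
        conditional mu1 A1 (B1 `&` phi @^-1` E) = conditional mu2 A2 E].

Definition stably_orbit_equivalent
    (T : pmp_action G1 mu1) (S : pmp_action G2 mu2) : Prop :=
  exists (A1 : set X1) (A2 : set X2) (phi : X1 -> X2),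
    [/\ measurable A1 /\ (0 < mu1 A1)%E,
        measurable A2 /\ (0 < mu2 A2)%E,
        phi @` A1 `<=` A2 &
        exists (B1 : set X1) (B2 : set X2),
          [/\ conull_in mu1 A1 B1, conull_in mu2 A2 B2,
              measure_iso_on A1 B1 A2 B2 phi &
              {ae mu1, forall x, B1 x ->
                phi @` (act_orbit T x `&` B1) =
                act_orbit S (phi x) `&` B2}]].

End StableOrbitEquivalence.

Definition standard_borel (R : realType) d (L : measurableType d) : Prop :=
  exists (M : completePseudoMetricType R) (f : L -> M),
    [/\ hausdorff_space M, exists2 D : set M, countable D & dense D,
        bijective f &
        forall A : set L, measurable A <-> <<s [set U : set M | open U] >> (f @` A)].

Definition nontrivial_base (R : realType) d (L : measurableType d)
    (lam : probability L R) : Prop :=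
  ~ exists l : L, lam [set l] = 1%E.

HB.instance Definition _ n := isPointed.Build 'I_n.+1 ord0.
HB.instance Definition _ n := @isMeasurable.Build default_measure_display
  'I_n.+1 discrete_measurable discrete_measurable0
  discrete_measurableC discrete_measurableU.

Section UniformZ2.
Variable R : realType.

Definition uniform_Z2 : set 'Z_2 -> \bar R :=
  mscale (2^-1 : R)%:nng (measure_add (\d_(0 : 'Z_2)) (\d_(1 : 'Z_2))).

HB.instance Definition _ := Measure.on uniform_Z2.

Let uniform_Z2_setT : uniform_Z2 setT = 1%E.
Proof.
rewrite /uniform_Z2 /mscale.
rewrite (_ : Measure.sort _ _ = 2%:E); first by rewrite -EFinM mulVf.
by rewrite [LHS]measure_addE /= !diracE !in_setT -EFinD.
Qed.

HB.instance Definition _ :=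
  Measure_isProbability.Build _ _ _ uniform_Z2 uniform_Z2_setT.

End UniformZ2.

(* Main.v *)
Require Import Defs.
From HB Require Import structures.
From mathcomp Require Import all_boot all_order all_algebra finmap.
From mathcomp Require Import all_classical all_reals all_analysis.
From mathcomp Require Import zify lra.

(* Call a point x a zero or a one according to its value at the coset <b>, and
   restrict the orbit relation to the set A of zeros, which has measure 1/2.
   Along the a-line of a zero the bits are independent and fair.  Let c1 send a
   zero to the next zero of its a-line, let alpha send a zero to the one matched
   with it when zeros and ones of the a-line are read as opening and closing
   parentheses, let c2 = b and c3 = alpha^-1 b alpha.  These generate a free
   action of F_3 on A whose orbits are the traces of those of F_2.  If n x is
   the number of ones between x and c1 x, then x |-> (n (w^-1 x))_w is the
   required isomorphism, the base space being nat with the law of n.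

   The matching exists almost surely because the probability q(h) that the walk
   started at height h never reaches 0 satisfies q(0) = 0, is harmonic and
   bounded, hence vanishes.  The code (n (w^-1 x))_w determines x since the
   cocycle of the F_3-action can be recomputed from it and the zeros are the
   vertices that this cocycle reaches.  For the product law, the words of a
   finite subset of F_3 are grouped by c1-lines.  In a line of maximal depth,
   conditioned on the vertex of F_2 through which it is entered, the labels
   depend only on coordinates that the labels of the other lines do not see. *)

Set Implicit Arguments.
Unset Strict Implicit.
Unset Printing Implicit Defensive.

Import Order.TTheory GRing.Theory Num.Theory.
Local Open Scope classical_set_scope.
Local Open Scope ring_scope.

(** * Matchings on a line *)

(** The value at the coset of b is unchanged by b, so b maps zeros to zeros and ones to ones. Its
    action on the zeros is kept; its action on the ones must be carried to the zeros by a bijection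
    within a-orbits, and the parenthesis matching is one. The rank agrees with the cost: inducing on
    a set of measure 1/2 doubles cost minus one, and 1 + 2 (2 - 1) = 3. The obstacle is
    independence: c3 reads a random stretch of an a-line, so the vertex reached by a word, and with
    it the label found there, depends on other lines. Three facts settle this. The entry of a line
    is determined by shallower lines. Seen from its entry, a line of maximal depth shares with the
    other lines only the bit at the entry, and the generator used to enter forces that bit; this
    gives a factor 2 that cancels the measure 1/2 of the zeros. Finally, moving from a one to its
    matched zero preserves the measure, so it does not matter whether a line is entered at a zero or
    at a one. *)

Section Search.
Implicit Types P Q : pred nat.

Definition search P : nat :=
  if pselect (exists n, P n) is left e then ex_minn e else 0%N.

Lemma searchP P : (exists n, P n) ->
  P (search P) /\ forall k, (k < search P)%N -> ~~ P k.
Proof.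
rewrite /search; case: pselect => // e _; case: ex_minnP => n Pn min; split=> // k.
by apply: contraL => /min; rewrite -leqNgt.
Qed.

Lemma search_eq P n : P n -> (forall k, (k < n)%N -> ~~ P k) -> search P = n.
Proof.
move=> Pn min; have [Ps mins] := searchP (ex_intro _ n Pn).
apply/eqP; rewrite eqn_leq; apply/andP; split; rewrite leqNgt; apply/negP.
  by move=> /mins; rewrite Pn.
by move=> /min; rewrite Ps.
Qed.

End Search.

Section Line.
Implicit Types f g : int -> bool.

Definition translate (k : int) f : int -> bool := fun i => f (i + k).
Definition mirror f : int -> bool := fun i => f (- i).
(** Reversal together with the exchange of parentheses: a one closed to its left becomes a zero
    closed to its right, so [match_dist (dual f)] is the distance from a one back to its zero. *)
Definition dual f : int -> bool := fun i => ~~ f (- i).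

Definition height f (r : nat) : int := \sum_(i < r) (if f i%:Z then 1 else -1).

(* In a line, true stands for a zero and false for a one.  When the search fails
   the value is 0. *)
Definition gap f : nat := search (fun j => f j.+1%:Z).
(* The zero at 0, read as an opening parenthesis, is closed by the one at
   match_dist f. *)
Definition match_dist f : nat := search (fun j => height f j.+1 == 0).

Definition line_good f :=
  [/\ exists j : nat, f j.+1%:Z, exists j : nat, f (- j.+1%:Z),
      f 0 -> exists j, height f j.+1 == 0 &
      ~~ f 0 -> exists j, height (dual f) j.+1 == 0].

Lemma heightS f r : height f r.+1 = height f r + (if f r%:Z then 1 else -1).
Proof. by rewrite /height big_ord_recr. Qed.

Lemma height0 f : height f 0 = 0.
Proof. by rewrite /height big_ord0. Qed.

Lemma mirror_translate k f : mirror (translate k f) = translate (- k) (mirror f).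
Proof. by apply/funext => i; rewrite /translate /mirror opprD opprK. Qed.

Lemma mirrorK : involutive mirror.
Proof. by move=> f; apply/funext => i; rewrite /mirror opprK. Qed.

Lemma gapP f : (exists j : nat, f j.+1%:Z) ->
  f (gap f).+1%:Z /\ forall k, (0 < k)%N -> (k <= gap f)%N -> ~~ f k%:Z.
Proof. by move=> /searchP[fg min]; split=> // -[] // k _; exact: min. Qed.

(** The ones between two consecutive zeros can be counted from either end; this lets a backward move
    be expressed by a forward gap. *)
Lemma gap_mirror f : (exists j : nat, f j.+1%:Z) -> f 0 ->
  gap (mirror (translate (gap f).+1%:Z f)) = gap f.
Proof.
move=> /gapP[fg min] f0; apply: search_eq => [|k kg].
  by rewrite /mirror /translate addNr.
rewrite /mirror /translate (_ : _ + _ = (gap f - k)%N%:Z); last by lia.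
by apply: min; lia.
Qed.

(** The walk steps first to height 1 and moves by units, so it stays positive until its first return
    to 0, and the returning step goes down. *)
Lemma match_distP f : f 0 -> (exists j, height f j.+1 == 0) ->
  [/\ height f (match_dist f).+1 = 0, ~~ f (match_dist f)%:Z &
      forall r, (0 < r <= match_dist f)%N -> 0 < height f r].
Proof.
move=> f0 /searchP[/eqP m0 min]; have pos r : (0 < r <= match_dist f)%N -> 0 < height f r.
  elim: r => // -[_ _|r IH rm]; first by rewrite heightS height0 f0.
  have := min r.+1; rewrite heightS => /(_ ltac:(move: rm; rewrite /match_dist; lia)).
  by have := IH ltac:(lia); case: ifP => _; lia.
split => //; apply/negP => fm; move: m0; rewrite heightS -/(match_dist f) fm.
case: (match_dist f) (pos (match_dist f)) => [|m] p; first by rewrite height0.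
by have := p ltac:(lia); lia.
Qed.

(** The total over the positions 0 to m vanishes, so the negated sum of the last r steps is the sum
    of the steps before them. *)
Lemma height_dual f (m r : nat) : (r <= m.+1)%N -> height f m.+1 = 0 ->
  height (dual (translate m%:Z f)) r = height f (m.+1 - r).
Proof.
move=> rm h0; elim: r rm => [|r IH] rm; first by rewrite subn0 h0 height0.
rewrite heightS IH; last by lia.
rewrite (_ : m.+1 - r = (m.+1 - r.+1).+1)%N; last by lia.
rewrite heightS /dual /translate (_ : - r%:Z + m%:Z = (m.+1 - r.+1)%N%:Z); last by lia.
by case: (f _) => /=; lia.
Qed.

(** The matching is an involution: read backwards from the closing one, the walk runs through the
    same positive heights and first returns to 0 at the opening zero. *)
Lemma match_dual f : f 0 -> (exists j, height f j.+1 == 0) ->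
  match_dist (dual (translate (match_dist f)%:Z f)) = match_dist f.
Proof.
move=> f0 em; have [h0 _ pos] := match_distP f0 em.
apply: search_eq => [|k km]; first by rewrite height_dual // subnn height0.
by rewrite height_dual //; [have := pos ((match_dist f).+1 - k.+1)%N|]; lia.
Qed.

Lemma match_dual_back f : ~~ f 0 -> (exists j, height (dual f) j.+1 == 0) ->
  let m := match_dist (dual f) in
  f (- m%:Z) /\ match_dist (translate (- m%:Z) f) = m.
Proof.
move=> f0 em /=; have g0 : dual f 0 by rewrite /dual oppr0.
have [_ gm _] := match_distP g0 em; split; first by move: gm; rewrite /dual negbK.
rewrite -[RHS](match_dual g0 em); congr match_dist; apply/funext => i.
by rewrite /dual /translate negbK opprD opprK.
Qed.

Lemma gap_back f : (exists j : nat, f (- j.+1%:Z)) -> f 0 ->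
  let n := gap (mirror f) in
  f (- n.+1%:Z) /\ gap (translate (- n.+1%:Z) f) = n.
Proof.
move=> eg f0 /=; have e : exists j : nat, mirror f j.+1%:Z by [].
have m0 : mirror f 0 by rewrite /mirror oppr0.
have [fg _] := gapP e; split => //.
by rewrite -[RHS](gap_mirror e m0) mirror_translate mirrorK.
Qed.

Lemma eq_height f g r : (forall i, (i < r)%N -> f i%:Z = g i%:Z) ->
  height f r = height g r.
Proof. by move=> fg; apply: eq_bigr => i _; rewrite fg. Qed.

Lemma eq_match_dist f g : (forall i : nat, f i%:Z = g i%:Z) ->
  match_dist f = match_dist g.
Proof.
move=> fg; congr search; apply/funext => j.
by rewrite (@eq_height f g).
Qed.

Lemma eq_gap f g : (forall i : nat, f i.+1%:Z = g i.+1%:Z) -> gap f = gap g.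
Proof. by move=> fg; congr search; apply/funext => j; rewrite fg. Qed.

End Line.

(** * Recovering a half-line of bits from its gaps *)

Section Reconstruction.

Definition zero_pos (y : nat -> nat) (k : nat) : nat := (\sum_(i < k) (y i).+1)%N.

(* Only the values at i >= 0 are meaningful. *)
Definition bits_of_gaps (y : nat -> nat) (i : int) : bool :=
  `[< exists k : nat, zero_pos y k = `|i|%N >].

(** The hypothesis is conditional on position k being a zero because this is itself proved by
    induction: each gap leads to the next zero. *)
Lemma bits_of_gapsE (f : int -> bool) (y : nat -> nat) : f 0 ->
  (forall k, f (zero_pos y k)%:Z ->
     [/\ y k = gap (translate (zero_pos y k)%:Z f) &
         exists j : nat, translate (zero_pos y k)%:Z f j.+1%:Z]) ->
  forall i : nat, bits_of_gaps y i%:Z = f i%:Z.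
Proof.
move=> f0 yf; have z k : f (zero_pos y k)%:Z.
  elim: k => [|k IH]; first by rewrite /zero_pos big_ord0.
  have [yk ek] := yf k IH; have [+ _] := gapP ek.
  by rewrite -yk /translate /zero_pos big_ord_recr /= PoszD addrC.
move=> i; apply/asboolP/idP => [[k]|fi]; first by rewrite absz_nat => <-.
(* No zero lies strictly between consecutive positions [zero_pos y k], so advancing k from 0 cannot
   jump over the zero at i; the induction is on the remaining distance. *)
suff H k : (zero_pos y k <= i)%N -> exists k, zero_pos y k = i.
  by have [|k <-] := H 0%N; [rewrite /zero_pos big_ord0|exists k].
have [n] := ubnP (i - zero_pos y k)%N; elim: n k => // n IH k lt le.
have [e|ne] := eqVneq (zero_pos y k) i; first by exists k.
have [yk ek] := yf k (z k); have [_ min] := gapP ek.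
have zS : zero_pos y k.+1 = (zero_pos y k + (y k).+1)%N.
  by rewrite /zero_pos big_ord_recr.
apply: (IH k.+1); rewrite zS; first by lia.
rewrite leqNgt; apply/negP => il; have := min (i - zero_pos y k)%N.
rewrite /translate (_ : (i - zero_pos y k)%N%:Z + _ = i%:Z) ?fi; last by lia.
by rewrite -yk => /(_ ltac:(lia) ltac:(lia)).
Qed.

End Reconstruction.

(** * Words in free groups *)

Section IntegerPowers.
Variable G : groupType.
Implicit Types x y : G.

Definition zexpg x (k : int) : G :=
  (match k with Posz n => x ^+ n | Negz n => x^-1 ^+ n.+1 end)%g.

Lemma zexpg0 x : zexpg x 0 = 1%g. Proof. by rewrite /= expg0. Qed.

Lemma zexpgS x k : zexpg x (1 + k) = (x * zexpg x k)%g.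
Proof.
case: k => n; first by rewrite /= expgS.
case: n => [|n]; first by rewrite /= expg1 mulgV.
rewrite (_ : 1 + Negz n.+1 = Negz n); last by lia.
by rewrite /= [in RHS]expgS mulVKg.
Qed.

Lemma zexpgN1 x k : zexpg x (-1 + k) = (x^-1 * zexpg x k)%g.
Proof. by rewrite -[in RHS](addrNK 1 k) [k - 1 + 1]addrC zexpgS mulKg addrC. Qed.

Lemma zexpgD x k l : zexpg x (k + l) = (zexpg x k * zexpg x l)%g.
Proof.
elim: k => [|n IH|n IH]; first by rewrite add0r zexpg0 mul1g.
  by rewrite -addn1 PoszD [n%:Z + 1]addrC -addrA !zexpgS IH mulgA.
by rewrite -addn1 PoszD opprD [- n%:Z + _]addrC -addrA !zexpgN1 IH mulgA.
Qed.

Lemma zexpgN x k : zexpg x (- k) = (zexpg x k)^-1%g.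
Proof. by apply: (mulgI (zexpg x k)); rewrite -zexpgD subrr zexpg0 mulgV. Qed.

Lemma zexpg1 x : zexpg x 1 = x. Proof. by rewrite /= expg1. Qed.

End IntegerPowers.

Section Words.
Variable n : nat.
Implicit Types (i : 'I_n) (s : seq (letter n)) (g h : free_group n).

Definition fg_letter (l : letter n) : free_group n := @FreeGroup n [:: l] isT.

Lemma val_letterM l g : val (fg_letter l * g)%g = push l (val g).
Proof. by []. Qed.

Lemma fg_letterV l : fg_letter (letter_inv l) = (fg_letter l)^-1%g.
Proof.
apply: (mulgI (fg_letter l)); rewrite mulgV; apply/val_inj.
by rewrite val_letterM /= eqxx.
Qed.

Definition fg_eval s : free_group n := foldr (fun l g => fg_letter l * g)%g 1%g s.

Lemma fg_eval_reduced s : reduced s -> val (fg_eval s) = s.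
Proof.
move=> rs; rewrite -[RHS](foldr_push_id rs) /fg_eval.
by elim: s {rs} => //= l s <-.
Qed.

Lemma fg_eval_val g : fg_eval (val g) = g.
Proof. by apply/val_inj; rewrite fg_eval_reduced // (valP g). Qed.

Lemma fg_ind (P : free_group n -> Prop) : P 1%g ->
  (forall l g, P g -> P (fg_letter l * g)%g) -> forall g, P g.
Proof.
move=> P1 PM g; rewrite -(fg_eval_val g).
by elim: (val g) => //= l s; exact: PM.
Qed.

(** Canonical representative of the right coset of the powers of the i-th generator; for i = 0 it
    names the line through a vertex or word. *)
Fixpoint strip i s : seq (letter n) :=
  if s is l :: s' then if l.1 == i then strip i s' else s else [::].

Lemma strip_push i l s : l.1 = i -> strip i (push l s) = strip i s.
Proof.
case: l => _ e /= ->; case: s => [|m s] /=; first by rewrite eqxx.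
by case: ifPn => [/eqP->|_] /=; rewrite eqxx.
Qed.

Lemma strip_id i s : strip i (strip i s) = strip i s.
Proof. by elim: s => //= l s IH; case: ifPn => //= /negbTE ->. Qed.

Lemma zexp_letter i k :
  zexpg (fg_letter (i, false)) k = (fg_letter (i, k < 0)%R ^+ `|k|)%g.
Proof.
by case: k => // m; rewrite /zexpg -fg_letterV.
Qed.

Lemma strip_zexp i k g :
  strip i (val (zexpg (fg_letter (i, false)) k * g)%g) = strip i (val g).
Proof.
rewrite zexp_letter; elim: `|k|%N => [|m IH]; first by rewrite expg0 mul1g.
by rewrite expgS -mulgA val_letterM strip_push.
Qed.

Lemma push_strip i b s : strip i s = s -> push (i, b) s = (i, b) :: s.
Proof.
case: s => //= l s; case: ifPn => [li H|li _]; last first.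
  by case: l li => j e /= ji; rewrite /letter_inv xpair_eqE (negbTE ji).
(* A word fixed by [strip i] cannot begin with index i, since stripping would shorten it. *)
have sz t : (size (strip i t) <= size t)%N.
  by elim: t => //= l' t' IH; case: ifP => // _; rewrite (leq_trans IH).
by have := sz s; rewrite H /= ltnn.
Qed.

Lemma val_zexp i k g : strip i (val g) = val g ->
  val (zexpg (fg_letter (i, false)) k * g)%g = nseq `|k| (i, k < 0)%R ++ val g.
Proof.
move=> hg; rewrite zexp_letter; elim: `|k|%N => [|m IH]; first by rewrite expg0 mul1g.
rewrite expgS -mulgA val_letterM IH.
case: m {IH} => [|m]; first exact: push_strip.
by rewrite /= /letter_inv xpair_eqE eqxx; case: (_ < _)%R.
Qed.

Lemma zexp_letter_inj i k k' g g' :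
  strip i (val g) = val g -> strip i (val g') = val g' ->
  (zexpg (fg_letter (i, false)) k * g = zexpg (fg_letter (i, false)) k' * g')%g ->
  k = k' /\ g = g'.
Proof.
move=> hg hg' e; have gg' : g = g'.
  by apply/val_inj; rewrite -hg -(strip_zexp i k) e strip_zexp.
split => //; subst g'; have := congr1 val e; rewrite !val_zexp // => /(congr1 rev).
rewrite !rev_cat => /eqP; rewrite eqseq_cat // eqxx /= !rev_nseq => /eqP H.
have sz : `|k|%N = `|k'|%N by have := congr1 size H; rewrite !size_nseq.
move: H; rewrite sz; case E: `|k'|%N => [|m] /=; first by lia.
by case=> H _; move: H; case: (ltP k 0); case: (ltP k' 0); lia.
Qed.

Lemma strip_reduced i s : reduced s -> reduced (strip i s).
Proof. by elim: s => //= l s IH rs; case: ifP => // _; apply/IH/reduced_behead/rs. Qed.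

Lemma strip_head i s l t : strip i s = l :: t -> l.1 != i.
Proof. by elim: s => //= m s IH; case: ifPn => // mi [<- _]. Qed.

(** For i = 0 this is the depth of a line, being constant along it. *)
Definition weight i s : nat := count (fun l => l.1 != i) s.

Lemma weight_strip i s : weight i (strip i s) = weight i s.
Proof. by rewrite /weight; elim: s => //= l s IH; case: ifPn => //= /negbTE->. Qed.

Lemma weight_zexp i k g :
  weight i (val (zexpg (fg_letter (i, false)) k * g)%g) = weight i (val g).
Proof. by rewrite -weight_strip strip_zexp weight_strip. Qed.

End Words.

(** * The cocycle of the F_3-action *)

Notation F2 := (free_group 2).
Notation F3 := (free_group 3).

Definition apow (k : int) : F2 := zexpg (fg_letter (ord0, false)) k.
Definition cpow (k : int) : F3 := zexpg (fg_letter (ord0, false)) k.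
Definition blet (e : bool) : F2 := fg_letter (ord_max, e).
Arguments apow : simpl never.
Arguments cpow : simpl never.
Arguments blet : simpl never.

Definition coloring := F2 -> bool.

Section Dynamics.
Implicit Types (c : coloring) (g h : F2) (w : F3) (l : letter 3) (s : seq (letter 3)).

(** The coloring seen from g x instead of x: the vertex h relative to g is the vertex h g. *)
Definition recenter g c : coloring := fun h => c (h * g)%g.
Definition aline c : int -> bool := fun k => c (apow k).

Lemma recenterM g h c : recenter g (recenter h c) = recenter (g * h)%g c.
Proof. by apply/funext => k; rewrite /recenter mulgA. Qed.

Lemma recenter1 c : recenter 1%g c = c.
Proof. by apply/funext => k; rewrite /recenter mulg1. Qed.

Lemma apowD k j : apow (k + j) = (apow k * apow j)%g.
Proof. exact: zexpgD. Qed.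

Lemma aline_recenter k c : aline (recenter (apow k) c) = translate k (aline c).
Proof. by apply/funext => i; rewrite /aline /recenter /translate apowD. Qed.

Lemma aline_recenterM k g c : aline (recenter (apow k * g)%g c) = translate k (aline (recenter g c)).
Proof. by rewrite -recenterM aline_recenter. Qed.

Definition b_invariant c := forall h, c (blet false * h)%g = c h.

Lemma b_invariantP c e h : b_invariant c -> c (blet e * h)%g = c h.
Proof.
case: e => // bc; rewrite -[in RHS](mulVKg (blet false) h) bc.
by rewrite -fg_letterV.
Qed.

Definition good c := forall g, line_good (aline (recenter g c)).

Definition admissible c := [/\ b_invariant c, good c & c 1%g].

Lemma admissible_recenter g c : admissible c -> c g -> admissible (recenter g c).
Proof.
move=> [bc gc _] cg; split; last by rewrite /recenter mul1g.
  by move=> h; rewrite /recenter -mulgA bc.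
by move=> h; rewrite recenterM; exact: gc.
Qed.

Lemma admissible_line c : admissible c -> line_good (aline c).
Proof. by case=> _ gc _; have := gc 1%g; rewrite recenter1. Qed.

(* From a zero, the first generator of F3 goes to the next zero of the a-line,
   the second one acts as b, and the third one is b conjugated by the matching
   of the zeros with the ones of each a-line. *)
Definition entry_step l c : F2 :=
  if l.1 == 1%N :> nat then blet l.2
  else (blet l.2 * apow (match_dist (aline c))%:Z)%g.

(** The third generator, read from right to left: go to the matched one, cross by b, which leads to
    another one, and return to the zero matched with it. *)
Definition step l c : F2 :=
  if l.1 == 0%N :> nat then
    if l.2 then apow (- (gap (mirror (aline c))).+1%:Z) else apow (gap (aline c)).+1%:Z
  else if l.1 == 1%N :> nat then entry_step l c
  else (apow (- (match_dist (dual (aline (recenter (entry_step l c) c))))%:Z)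
        * entry_step l c)%g.

Lemma I3P (i : 'I_3) : [\/ i = ord0, i = @Ordinal 3 1 isT | i = ord_max].
Proof.
case: i => -[|[|[|//]]] Hi; [constructor 1|constructor 2|constructor 3]; exact/val_inj.
Qed.

Lemma aline0 c : aline c 0 = c 1%g.
Proof. by []. Qed.

Lemma entry_step_one e c : admissible c ->
  c (entry_step (ord_max : 'I_3, e) c) = false.
Proof.
move=> ac; have [bc _ c1] := ac; have [_ _ /(_ c1) em _] := admissible_line ac.
have [_ /negbTE fm _] := match_distP (c1 : aline c 0) em.
by rewrite /entry_step /= b_invariantP.
Qed.

Lemma step_zero l c : admissible c -> c (step l c).
Proof.
move=> ac; have [bc gc c1] := ac; have [eg eg' em em'] := admissible_line ac.
case: l => i e; have [->|->|->] := I3P i; rewrite /step /=.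
- by case: e; [have [] := gap_back eg' c1|have [] := gapP eg].
- by rewrite -[X in c X]mulg1 b_invariantP.
have := gc (entry_step (ord_max : 'I_3, e) c) => -[_ _ _ H].
have c0 : ~~ aline (recenter (entry_step (ord_max : 'I_3, e) c) c) 0.
  by rewrite /aline /recenter mul1g entry_step_one.
by have [] := match_dual_back c0 (H c0).
Qed.

Lemma step_admissible l c : admissible c -> admissible (recenter (step l c) c).
Proof. by move=> ac; apply: admissible_recenter => //; exact: step_zero. Qed.

(** For the third generator the middle legs and then the outer legs cancel, because the matching is
    an involution on each of the two a-lines involved. *)
Lemma stepV l c : admissible c ->
  (step (letter_inv l) (recenter (step l c) c) * step l c)%g = 1%g.
Proof.
move=> ac; have [bc gc c1] := ac; have [eg eg' em em'] := admissible_line ac.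
case: l => i e; have [->|->|->] := I3P i; rewrite /step /=.
- case: e => /=; rewrite aline_recenter.
    by have [_ ->] := gap_back eg' c1; rewrite -apowD subrr.
  by rewrite gap_mirror // -apowD addNr.
- by rewrite /entry_step /= /blet -[(_, ~~ e)]/(letter_inv (_, e)) fg_letterV mulVg.
set g := entry_step (ord_max, e) c; set m' := match_dist (dual (aline (recenter g c))).
have c0 : ~~ aline (recenter g c) 0 by rewrite /aline /recenter mul1g entry_step_one.
have [_ _ _ /(_ c0) H] := gc g; have [_ mm'] := match_dual_back c0 H.
have -> : entry_step (ord_max, ~~ e) (recenter (apow (- m'%:Z) * g)%g c) =
    (blet (~~ e) * apow m'%:Z)%g by rewrite /entry_step /= aline_recenterM mm'.
have be : (blet (~~ e) * blet e = 1)%g.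
  by rewrite /blet -[(_, ~~ e)]/(letter_inv (_, e)) fg_letterV mulVg.
have bb : (blet (~~ e) * apow m'%:Z * (apow (- m'%:Z) * g) =
           apow (match_dist (aline c))%:Z)%g.
  by rewrite -!mulgA (mulgA (apow _) (apow _)) -apowD subrr mul1g mulgA be mul1g.
rewrite recenterM bb aline_recenter match_dual //; last exact: em.
by rewrite -mulgA bb -apowD addNr.
Qed.

Fixpoint word_cocycle s c : F2 :=
  if s is l :: s' then
    let g := word_cocycle s' c in (step l (recenter g c) * g)%g
  else 1%g.

Definition cocycle w c : F2 := word_cocycle (val w) c.

Lemma word_cocycle_zero s c : admissible c -> c (word_cocycle s c).
Proof.
move=> ac; have [_ _ c1] := ac; elim: s => //= l s IH.
have := step_zero l (admissible_recenter ac IH).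
by rewrite /recenter.
Qed.

Lemma cocycle_admissible s c : admissible c -> admissible (recenter (word_cocycle s c) c).
Proof. by move=> ac; apply: admissible_recenter => //; exact: word_cocycle_zero. Qed.

Lemma word_cocycle_push l s c : admissible c ->
  word_cocycle (push l s) c = word_cocycle (l :: s) c.
Proof.
move=> ac; case: s => // m s; rewrite /push; case: ifPn => // /eqP -> /=.
rewrite -recenterM mulgA -[l in step l]letter_invK stepV ?mul1g //.
exact: cocycle_admissible.
Qed.

Lemma cocycleM w w' c : admissible c ->
  cocycle (w * w')%g c = (cocycle w (recenter (cocycle w' c) c) * cocycle w' c)%g.
Proof.
move=> ac; rewrite /cocycle -[val (w * w')%g]/(foldr (@push 3) (val w') (val w)).
elim: (val w) => [|l s IH] /=; first by rewrite mul1g.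
by rewrite word_cocycle_push //= IH recenterM mulgA.
Qed.

Lemma cocycle1 c : cocycle 1%g c = 1%g.
Proof. by []. Qed.

Lemma cocycle_letter l c : cocycle (fg_letter l) c = step l c.
Proof. by rewrite /cocycle /= recenter1 mulg1. Qed.

Lemma cpowD k j : cpow (k + j) = (cpow k * cpow j)%g.
Proof. exact: zexpgD. Qed.

Lemma cpow_letter e : cpow (if e then -1 else 1) = fg_letter (ord0, e).
Proof. by case: e; rewrite /cpow ?zexpg1 //= expg1 -fg_letterV. Qed.

(** A step of c1 towards k cannot pass k, as no zero lies inside a gap; hence the distance to k
    decreases. *)
Lemma apow_reach k c : admissible c -> c (apow k) ->
  exists j, cocycle (cpow j) c = apow k.
Proof.
have [n] := ubnP `|k|%N; elim: n k c => // n IH k c kn ac ck.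
have [_ _ c1] := ac; have [eg eg' _ _] := admissible_line ac.
have [->|k0] := eqVneq k 0; first by exists 0.
pose e := k < 0; have [d dk] : exists2 d : int, step (ord0, e) c = apow d & (`|k - d| < `|k|)%N.
  rewrite /step /= /e; case: ltP => k_0.
    exists (- (gap (mirror (aline c))).+1%:Z) => //.
    have e' : exists j : nat, mirror (aline c) j.+1%:Z by [].
    have [_ min] := gapP e'; suff : ~~ (`|k| <= gap (mirror (aline c)))%N by lia.
    apply/negP => le; have := min `|k|%N ltac:(lia) le.
    by rewrite /mirror (_ : - `|k|%N%:Z = k) ?/aline ?ck //; lia.
  exists (gap (aline c)).+1%:Z => //.
  have [_ min] := gapP eg; suff : ~~ (`|k| <= gap (aline c))%N by lia.
  apply/negP => le; have := min `|k|%N ltac:(lia) le.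
  by rewrite (_ : `|k|%N%:Z = k) ?/aline ?ck //; lia.
move=> lt; have [||j Hj] := IH (k - d) (recenter (step (ord0, e) c) c) ltac:(lia).
- exact: step_admissible.
- by rewrite /recenter dk -apowD subrK.
exists (j + (if e then -1 else 1)); rewrite cpowD cpow_letter.
by rewrite cocycleM // cocycle_letter Hj dk -apowD subrK.
Qed.

(** Sign of the displacement k caused by the leading c1-letters of s. It is strict when there are
    any, so a nonempty reduced run never returns to its starting zero. *)
Definition run_sign s (k : int) : bool :=
  if s is l :: _ then
    if l.1 == ord0 then (if l.2 then k < 0 else 0 < k) else k == 0
  else k == 0.

Lemma run_sign_cons l s (d k : int) : reduced (l :: s) -> l.1 = ord0 ->
  0 < d -> run_sign s k -> run_sign (l :: s) ((if l.2 then - d else d) + k).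
Proof.
move=> rs l0 d0; rewrite /run_sign l0 eqxx.
case: s rs => [_ /eqP->|m s]; first by case: l.2; lia.
rewrite /reduced /= => /andP[ml _]; case: eqP => [m0|_ /eqP ->]; last by case: l.2; lia.
suff -> : m.2 = l.2 by case: l.2; lia.
apply/eqP; apply: contraNT ml => e.
by apply/eqP; rewrite [m]surjective_pairing m0 -l0 /letter_inv; congr pair; move: e; case: l.2; case: m.2.
Qed.

Lemma cocycle_run s c : admissible c -> reduced s ->
  exists2 k, word_cocycle s c = (apow k * word_cocycle (strip ord0 s) c)%g &
    run_sign s k.
Proof.
move=> ac; elim: s => [_|l s IH rs]; first by exists 0; rewrite ?mulg1.
have [l0|l0] := eqVneq l.1 ord0; last first.
  by exists 0; rewrite /= (negbTE l0) ?mul1g.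
have [k Hk sk] := IH (reduced_behead rs).
pose d := if l.2 then (gap (mirror (aline (recenter (word_cocycle s c) c)))).+1
          else (gap (aline (recenter (word_cocycle s c) c))).+1.
exists ((if l.2 then - d%:Z else d%:Z) + k); last first.
  by apply: run_sign_cons => //; rewrite /d; case: ifP.
by rewrite /= {2}Hk /step /d l0 eqxx /= apowD -mulgA; case: l.2.
Qed.

End Dynamics.

(** * Normal form of the vertices reached by words *)

Section NormalForm.
Implicit Types (c : coloring) (g h : F2) (w : F3) (l : letter 3) (s : seq (letter 3)).

(* The vertex through which the path of s enters its last a-line. *)
Definition entry s c : F2 :=
  if strip ord0 s is l :: s' then
    (entry_step l (recenter (word_cocycle s' c) c) * word_cocycle s' c)%g
  else 1%g.

(** Whether the last a-line is entered by the third generator, that is, at a one. *)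
Definition third s : bool :=
  if strip ord0 s is l :: _ then l.1 == 2%N :> nat else false.

(** Displacement from the entry to the zero on which the entering generator lands; it is nontrivial
    only when the entry is a one. *)
Definition base_offset s c : int :=
  if third s then - (match_dist (dual (aline (recenter (entry s c) c))))%:Z else 0.

Lemma apow_inj k g : (apow k * g)%g = g -> k = 0.
Proof.
move=> e; have : apow k = 1%g by apply: (mulIg g); rewrite mul1g.
rewrite /apow -[X in X = _]mulg1 => e'; have [] // := @zexp_letter_inj 2 ord0 k 0 1%g 1%g.
by rewrite e' zexpg0 mulg1.
Qed.

Lemma word_cocycle_strip s c : admissible c ->
  word_cocycle (strip ord0 s) c = (apow (base_offset s c) * entry s c)%g.
Proof.
rewrite /base_offset /third /entry => ac; case E: (strip ord0 s) => [|l t]; first by rewrite mul1g.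
have := strip_head E; case: l {E} => i e; have [->|->|->] := I3P i => // _.
  by rewrite /= mul1g.
by rewrite /= -mulgA /step /= recenterM.
Qed.

Lemma entry_zero s c : admissible c -> c (entry s c) = ~~ third s.
Proof.
rewrite /third /entry => ac; case E: (strip ord0 s) => [|l t]; first by case: ac.
have at' := cocycle_admissible t ac.
have := strip_head E; case: l {E} => i e; have [->|->|->] := I3P i => // _ /=.
  by have [bc _ _] := ac; rewrite /entry_step /= b_invariantP // word_cocycle_zero.
by have := entry_step_one e at'; rewrite /recenter.
Qed.

Lemma I3_eq (i j : 'I_3) : i != ord0 -> j != ord0 ->
  (i == 2%N :> nat) = (j == 2%N :> nat) -> i = j.
Proof. by have [->|->|->] := I3P i; have [->|->|->] := I3P j. Qed.

(* No cancellation occurs at the entries: two consecutive b-letters of the path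
   come from the same generator, so their signs agree because s is reduced. *)
Lemma normal_form s c : admissible c -> reduced s ->
  weight ord0 (val (entry s c)) = weight ord0 s /\
  (if strip ord0 s is l :: _ then
     exists t, val (entry s c) = (ord_max, l.2) :: t else entry s c = 1%g).
Proof.
move=> ac; elim: s => // l s IH rs; have [w1 hd] := IH (reduced_behead rs).
have [l0|l0] := eqVneq l.1 ord0.
  by rewrite /entry /= l0 eqxx /= -/(entry s c) w1 /weight /= ?l0 ?eqxx.
have st : strip ord0 (l :: s) = l :: s by rewrite /= (negbTE l0).
rewrite st.
have hid : strip ord0 (val (entry s c)) = val (entry s c).
  by move: hd; case: (strip _ _) => [->//|m _ [t ->]].
have [r Hr sr] := cocycle_run ac (reduced_behead rs).
move: Hr; rewrite word_cocycle_strip // mulgA -apowD; set o := base_offset _ _ => Hr.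
(* Displacement on the old line from its entry to the vertex where it is left: up to the current
   zero, and on to the matched one if l is the third generator. *)
pose k := (if l.1 == 1%N :> nat then 0
   else (match_dist (aline (recenter (word_cocycle s c) c)))%:Z) + (r + o).
have eE : entry (l :: s) c = (blet l.2 * (apow k * entry s c))%g.
  rewrite /entry st -/(entry s c) /entry_step /k; case: ifP => _; rewrite apowD.
    by rewrite mul1g -Hr.
  by rewrite -!mulgA -Hr.
suff H : val (entry (l :: s) c) = (ord_max, l.2) :: val (apow k * entry s c)%g.
  split; last by eexists; exact: H.
  rewrite H -[RHS]/((l.1 != ord0) + weight ord0 s)%N l0 -w1.
  by rewrite -[LHS]/(1 + weight ord0 (val (apow k * entry s c)%g))%N weight_zexp.
rewrite eE val_letterM /apow val_zexp //.
(* A nonzero power of a separates the two b-letters; for k = 0 they cancel only if their signs are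
   opposite. *)
have [k0|] := eqVneq k 0; last by case: (k) => [[|?]|?].
rewrite k0 /=; move: hd; case E: (strip ord0 s) => [|m t]; first by move=> ->.
move=> [u ->] /=; case: eqP => // -[] me.
(* Standing at the zero where the line was first reached means displacement 0, so by [run_sign] the
   word s does not begin with a run of c1. *)
have sm : word_cocycle s c = word_cocycle (strip ord0 s) c -> s = m :: t.
  move=> e; have r0 : r = 0.
    apply: (@apow_inj _ (word_cocycle (strip ord0 s) c)).
    by rewrite -[in RHS]e Hr apowD -mulgA word_cocycle_strip.
  move: sr E; rewrite r0 /run_sign; case: (s) => //= l' s'.
  by case: ifP => // _; case: l'.2; rewrite ltxx.
suff [e ml] : word_cocycle s c = word_cocycle (strip ord0 s) c /\ m.1 = l.1.
  move: rs; rewrite sm // /reduced /= => /andP[/eqP nm _]; case: nm.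
  by rewrite [m]surjective_pairing /letter_inv ml me.
have as' := cocycle_admissible s ac; have zs := word_cocycle_zero s ac.
have te := entry_zero s ac.
have tm : third s = (m.1 == 2%N :> nat) by rewrite /third E.
have m0 := strip_head E.
(* As k = 0, the old line is left through its entry. If this is a zero, both letters are c2; if it
   is a one, both are c3. *)
move: k0; rewrite /k; case: ifPn => [l1|l1].
  rewrite add0r => ro; have we : word_cocycle s c = entry s c by rewrite Hr ro mul1g.
  have tF : third s = false by move: te; rewrite -we zs; case: (third s).
  split; first by rewrite word_cocycle_strip // /base_offset tF mul1g.
  by apply: I3_eq => //; rewrite -tm tF (eqP l1).
move=> /esym/eqP; rewrite addrC -subr_eq add0r => /eqP/esym ro.
pose d := match_dist (aline (recenter (word_cocycle s c) c)).
have we : entry s c = (apow d%:Z * word_cocycle s c)%g.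
  by rewrite Hr mulgA -apowD ro addrN mul1g.
have fz : aline (recenter (word_cocycle s c) c) 0 by rewrite aline0; case: as'.
have [_ _ /(_ fz) em _] := admissible_line as'; have [_ fd _] := match_distP fz em.
have tT : third s by move: te; rewrite {1}we [c _](negbTE fd); case: (third s).
split.
  rewrite word_cocycle_strip // /base_offset tT we aline_recenterM match_dual //.
  by rewrite mulgA -apowD addNr mul1g.
apply: I3_eq => //; rewrite -tm tT; move: l1 l0.
by have [->|->|->] := I3P l.1.
Qed.

End NormalForm.

(** * Freeness, and transitivity on the zeros of an orbit *)

Section Freeness.
Implicit Types (c : coloring) (g h : F2) (w : F3) (l : letter 3) (s : seq (letter 3)).

Lemma cocycle_offset s c : admissible c -> reduced s ->
  exists k, word_cocycle s c = (apow k * entry s c)%g.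
Proof.
move=> ac rs; have [k -> _] := cocycle_run ac rs.
by exists (k + base_offset s c); rewrite word_cocycle_strip // mulgA -apowD.
Qed.

Lemma strip_entry s c : admissible c -> reduced s ->
  strip ord0 (val (entry s c)) = val (entry s c).
Proof.
move=> ac rs; have [_] := normal_form ac rs.
by case: (strip _ s) => [->//|m _ [t ->]].
Qed.

(** By [normal_form] such a word has weight 0, hence is a run of c1, and a nonempty reduced run has
    nonzero displacement. *)
Lemma cocycle_eq1 w c : admissible c -> cocycle w c = 1%g -> w = 1%g.
Proof.
move=> ac w1; have rw := valP w; have [k kw] := cocycle_offset ac rw.
have [+ _] := normal_form ac rw.
rewrite -(weight_zexp ord0 k) -/(apow k) -kw -/(cocycle _ _) w1 => /esym.
move: rw w1; rewrite /cocycle; case E : (val w) => [|l s] rs w1; first by move=> _; exact/val_inj.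
have [r Hr sr] := cocycle_run ac rs => ws.
have st : strip ord0 (l :: s) = [::].
  move: ws; rewrite -weight_strip /weight; case ES: (strip _ _) => [//|m t] /=.
  by rewrite (strip_head ES).
have r0 : r = 0 by apply: (@apow_inj _ 1%g); move: Hr; rewrite st w1 => <-.
move: st sr; rewrite r0 /=; case: ifP => // _ _.
by case: l.2; rewrite ltxx.
Qed.

Lemma cocycle_inj w w' c : admissible c -> cocycle w c = cocycle w' c -> w = w'.
Proof.
move=> ac e; apply: (mulIg w'^-1%g); rewrite mulgV; set c' := recenter (cocycle w' c) c.
apply: (@cocycle_eq1 _ c'); first exact: cocycle_admissible.
apply: (mulIg (cocycle w' c)); rewrite mul1g -cocycleM //.
by rewrite mulgVK.
Qed.

Lemma strip_cpow k w : strip ord0 (val (cpow k * w)%g) = strip ord0 (val w).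
Proof. exact: strip_zexp. Qed.

(* Two zeros on the same a-line differ by a power of the first generator. *)
Lemma entry_inj w w' c : admissible c ->
  entry (val w) c = entry (val w') c -> strip ord0 (val w) = strip ord0 (val w').
Proof.
move=> ac e; pose u := fg_eval (strip ord0 (val w)); pose u' := fg_eval (strip ord0 (val w')).
have su : val u = strip ord0 (val w) by rewrite fg_eval_reduced // strip_reduced // (valP w).
have su' : val u' = strip ord0 (val w') by rewrite fg_eval_reduced // strip_reduced // (valP w').
pose k := base_offset (val w') c - base_offset (val w) c.
have ku : cocycle u' c = (apow k * cocycle u c)%g.
  by rewrite /cocycle su su' !word_cocycle_strip // e mulgA -apowD subrK.
have [|j Hj] := @apow_reach k (recenter (cocycle u c) c) (cocycle_admissible _ ac).
  by rewrite /recenter -ku word_cocycle_zero.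
have -> : strip ord0 (val w') = strip ord0 (val u').
  by rewrite su' strip_id.
have -> : u' = (cpow j * u)%g by apply: (@cocycle_inj _ _ c) => //; rewrite cocycleM // Hj.
by rewrite strip_cpow su strip_id.
Qed.

Lemma I2_eq (i : 'I_2) : i != ord0 -> i = ord_max.
Proof. by case: i => -[|[|//]] Hi // _; exact/val_inj. Qed.

(** Prefixes of g may be ones, so the induction over letters keeps only that g lies on the a-line of
    a reached zero; [reach] concludes when g is a zero. *)
Lemma cocycle_onto g c : admissible c -> c g -> exists w, cocycle w c = g.
Proof.
move=> ac cg; have [bc gc c1] := ac.
have reach k w : c (apow k * cocycle w c)%g -> exists w', cocycle w' c = (apow k * cocycle w c)%g.
  move=> ck; have [j Hj] := apow_reach (cocycle_admissible (val w) ac) ck.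
  by exists (cpow j * w)%g; rewrite cocycleM // Hj.
suff [w [k E]] : exists w, exists k, g = (apow k * cocycle w c)%g.
  by have := reach k w; rewrite -E => /(_ cg).
elim/fg_ind: g {cg} => [|[i e] g [w [k gE]]]; first by exists 1%g, 0; rewrite mul1g.
have [i0|i0] := eqVneq i ord0.
  exists w, ((if e then -1 else 1) + k); rewrite i0 apowD -mulgA -gE; congr (_ * _)%g.
  by case: (e); rewrite /apow ?zexpg1 //= expg1 -fg_letterV.
rewrite (I2_eq i0) -/(blet e) => {i i0}.
have [cg|cg] := boolP (c g).
  have [w' Hw'] := reach k w ltac:(by rewrite -gE).
  exists (fg_letter (@Ordinal 3 1 isT, e) * w')%g, 0.
  by rewrite cocycleM // cocycle_letter mul1g Hw' -gE.
have [_ _ _ em] := gc g; have g0 : ~~ aline (recenter g c) 0 by rewrite /aline /recenter mul1g.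
have [zm mm] := match_dual_back g0 (em g0); set m := match_dist _ in zm mm.
have [w' Hw'] := reach (- m%:Z + k) w ltac:(by rewrite apowD -mulgA -gE).
have Hg : cocycle w' c = (apow (- m%:Z) * g)%g by rewrite Hw' apowD -mulgA -gE.
pose c' := recenter (cocycle w' c) c.
(* Apply c3 at the zero matched with g; the power of a undoes its last leg and leads back to the one
   [blet e * g]. *)
exists (fg_letter (ord_max, e) * w')%g, (match_dist (dual (aline (recenter (entry_step (ord_max : 'I_3, e) c') c'))))%:Z.
rewrite cocycleM // cocycle_letter /step /= !mulgA -apowD subrr mul1g.
rewrite /entry_step /= /c' Hg aline_recenterM mm -mulgA (mulgA (apow _)) -apowD.
by rewrite addrN mul1g.
Qed.

End Freeness.

(** * Which colours a cocycle depends on *)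

Section Dependence.
Implicit Types (c : coloring) (g h : F2) (w : F3) (l : letter 3) (s : seq (letter 3)).

(* The vertices carrying the same coset of <b> as some vertex of the a-line of
   g other than g itself. *)
Definition branch g h : Prop :=
  exists j i, i != 0 /\ h = (zexpg (blet false) j * (apow i * g))%g.

(** Stripping leading b-letters from an element of the branch leaves a^k g with k nonzero. If i is
    nonzero, nothing is stripped from a^i h, whence h = g. If i = 0 and h is not 1, stripping makes
    h lighter than g. *)
Lemma branch_line g h i : strip ord0 (val h) = val h -> strip ord0 (val g) = val g ->
  (weight ord0 (val h) <= weight ord0 (val g))%N -> h <> g \/ i = 0 ->
  ~ branch g (apow i * h)%g.
Proof.
move=> sh sg le hg [j [k [k0 E]]].
have top (x : int) (u : F2) : x != 0 -> strip ord0 (val u) = val u ->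
    strip ord_max (val (apow x * u)%g) = val (apow x * u)%g.
  by move=> x0 su; rewrite /apow val_zexp //; case X: `|x|%N => [|m] //; lia.
have sE : strip ord_max (val (apow i * h)%g) = val (apow k * g)%g.
  by rewrite E strip_zexp top.
have [i0|i0] := eqVneq i 0; last first.
  have : (apow i * h)%g = (apow k * g)%g by apply/val_inj; rewrite -sE top.
  move=> /(zexp_letter_inj sh sg) [_ hgE]; case: hg => [|i0']; first by [].
  by rewrite i0' in i0.
move: sE; rewrite i0 mul1g => sE.
have : (weight ord0 (strip ord_max (val h)) < weight ord0 (val h))%N || (val h == [::]).
  move: sh; case: (val h) => // l t /strip_head l0; rewrite /= (I2_eq l0) eqxx orbF.
  rewrite /= add1n ltnS; elim: t => //= m t IH; case: ifP => // _.
  by rewrite (leq_trans IH) // leq_addl.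
rewrite sE weight_zexp ltnNge le /= => /eqP h0.
by move: sE; rewrite (h0 : val h = [::]) => /esym; rewrite /apow val_zexp //; case X: `|k|%N => [|m] //; lia.
Qed.

Lemma branch_irrefl1 : ~ branch 1%g 1%g.
Proof.
by have := @branch_line 1%g 1%g 0 erefl erefl (leqnn _) (or_intror erefl); rewrite mul1g.
Qed.

Lemma branch_b g h j : branch g h -> branch g (zexpg (blet false) j * h)%g.
Proof.
by move=> [j' [i [i0 ->]]]; exists (j + j'), i; rewrite zexpgD mulgA.
Qed.

Definition agree_off g c c' := forall h, ~ branch g h -> c h = c' h.

(** Up to its entry a path reads only lines shallower than g, which avoid the branch of g. So the
    entry agrees even when it is g, and the line beyond it agrees when it is not. *)
Lemma cocycle_agree g s c c' : strip ord0 (val g) = val g ->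
  admissible c -> admissible c' -> agree_off g c c' ->
  reduced s -> (weight ord0 s <= weight ord0 (val g))%N ->
  entry s c' = entry s c /\
  (entry s c <> g -> word_cocycle s c' = word_cocycle s c /\
     aline (recenter (word_cocycle s c) c') = aline (recenter (word_cocycle s c) c)).
Proof.
move=> sg ac ac' cc'; have line_eq h : strip ord0 (val h) = val h ->
    (weight ord0 (val h) <= weight ord0 (val g))%N -> h <> g ->
    aline (recenter h c') = aline (recenter h c).
  move=> sh le hg; apply/funext => i; apply/esym/cc'.
  by apply: branch_line => //; left.
elim: s => [_ _|l s IH rs].
  by split=> // g1; split=> //; apply: line_eq => // -[].
have rs' := reduced_behead rs; have [l0|l0] := eqVneq l.1 ord0.
  rewrite /entry /weight /= l0 eqxx /= -!/(entry s _) => le.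
  have [e IH'] := IH rs' le; split=> // /IH'[-> le'].
  have st : step l (recenter (word_cocycle s c) c') = step l (recenter (word_cocycle s c) c).
    by rewrite /step l0 /= le'.
  by rewrite st; split=> //; rewrite /step l0 /=; case: l.2; rewrite !aline_recenterM le'.
move=> le; have le1 : (weight ord0 s < weight ord0 (val g))%N.
  by move: le; rewrite /weight /= l0.
have [_ [|wE lE]] := IH rs' (ltnW le1).
  by move=> eg; have [] := normal_form ac rs'; rewrite eg => wg _; rewrite wg ltnn in le1.
have eE : entry (l :: s) c' = entry (l :: s) c.
  by rewrite /entry /= (negbTE l0) wE /entry_step lE.
split=> // eg; have [we _] := normal_form ac rs.
have lE' := line_eq _ (strip_entry ac rs) ltac:(by rewrite we) eg.
have wcE c0 : admissible c0 -> word_cocycle (l :: s) c0 =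
    (apow (base_offset (l :: s) c0) * entry (l :: s) c0)%g.
  by move=> ac0; rewrite -word_cocycle_strip //= (negbTE l0).
have bE : base_offset (l :: s) c' = base_offset (l :: s) c.
  by rewrite /base_offset eE lE'.
by rewrite !wcE // bE eE; split=> //; rewrite !aline_recenterM lE'.
Qed.

Lemma cpow_cocycle_line k c c' : aline c = aline c' ->
  cocycle (cpow k) c = cocycle (cpow k) c' /\
  aline (recenter (cocycle (cpow k) c) c) = aline (recenter (cocycle (cpow k) c) c').
Proof.
move=> cc'; have : all (fun l => l.1 == ord0) (val (cpow k)).
  by rewrite -[cpow k]mulg1 /cpow val_zexp // cats0; apply/allP => l /nseqP[->].
rewrite /cocycle; elim: (val _) => [|l s IH] /=; first by rewrite !recenter1.
move=> /andP[/eqP l0 /IH[<- E]].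
have sE : step l (recenter (word_cocycle s c) c) = step l (recenter (word_cocycle s c) c').
  by rewrite /step l0 E.
by rewrite -sE /step l0 /=; split => //; case: l.2; rewrite !aline_recenterM E.
Qed.

(** Nonnegative powers of c1 never look back; this separates the later gaps of a line from the first
    one. *)
Lemma cpow_cocycle_nat (k : nat) c c' : (forall i : nat, aline c i%:Z = aline c' i%:Z) ->
  cocycle (cpow k%:Z) c = cocycle (cpow k%:Z) c' /\
  exists m : nat, cocycle (cpow k%:Z) c = apow m%:Z.
Proof.
move=> cc'; have -> : cocycle (cpow k%:Z) = word_cocycle (nseq k (ord0, false)).
  by apply/funext => d; rewrite -[cpow k]mulg1 /cocycle /cpow val_zexp // cats0.
elim: k => [|k [IH [m Hm]]] /=; first by split=> //; exists 0%N.
rewrite -IH Hm /step /= !aline_recenter.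
have E : gap (translate m (aline c)) = gap (translate m (aline c')).
  by apply: eq_gap => i; rewrite /translate -PoszD.
split; first by rewrite E.
by eexists; rewrite -apowD -PoszD.
Qed.

End Dependence.

(** * Recovering the cocycle from the gaps *)

Section Decoding.
Implicit Types (c : coloring) (g h : F2) (w : F3) (l : letter 3) (s : seq (letter 3)).

Definition gap_code c : F3 -> nat := fun w => gap (aline (recenter (cocycle w^-1%g c) c)).

(** The one matched with a zero lies ahead of it, and the bits ahead are given by the gaps at the
    successive images under c1. *)
Definition match_of_code (y : F3 -> nat) w : nat :=
  match_dist (bits_of_gaps (fun k => y (cpow k%:Z * w)^-1%g)).

(** Labels describe only what lies ahead, so backward legs are read at their destination: the
    inverse of c1 by the gap of the previous zero, the last leg of c3 by the match distance of the
    zero where it ends. *)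
Fixpoint cocycle_of_code (y : F3 -> nat) s : F2 :=
  if s is l :: s' then
    let w := fg_eval s' in
    ((if l.1 == 0%N :> nat then
        if l.2 then apow (- (y (fg_letter l * w)^-1%g).+1%:Z) else apow (y w^-1%g).+1%:Z
      else if l.1 == 1%N :> nat then blet l.2
      else apow (- (match_of_code y (fg_letter l * w)%g)%:Z) *
           (blet l.2 * apow (match_of_code y w)%:Z)) * cocycle_of_code y s')%g
  else 1%g.

(** Equivariance under the shift, whose convention explains the inverse in [gap_code]. *)
Lemma gap_code_move w c : admissible c ->
  gap_code (recenter (cocycle w c) c) = fun v => gap_code c (w^-1 * v)%g.
Proof.
move=> ac; apply/funext => v; rewrite /gap_code invgM invgK cocycleM // recenterM.
by [].
Qed.

Lemma match_of_codeE w c : admissible c ->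
  match_of_code (gap_code c) w = match_dist (aline (recenter (cocycle w c) c)).
Proof.
move=> ac; have ac' := cocycle_admissible (val w) ac.
rewrite /match_of_code; set c' := recenter _ c; apply: eq_match_dist.
set y := (fun k : nat => _); have yE k : y k = gap (aline (recenter (cocycle (cpow k) c') c')).
  by rewrite /y /gap_code invgK cocycleM // recenterM.
have zE k : cocycle (cpow k%:Z) c' = apow (zero_pos y k)%:Z.
  elim: k => [|k IH]; first by rewrite /zero_pos big_ord0.
  rewrite intS cpowD (cpow_letter false) cocycleM // cocycle_letter /step /= IH.
  have := yE k; rewrite IH => <-; rewrite -apowD; congr apow.
  by rewrite /zero_pos big_ord_recr /= PoszD addrC.
apply: bits_of_gapsE => [|k fk]; first by case: ac'.
rewrite yE zE aline_recenter; split => //.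
have [_ gc' _] := ac'; have [H _ _ _] := gc' (apow (zero_pos y k)%:Z).
by rewrite aline_recenter in H.
Qed.

Lemma cocycle_of_codeE s c : admissible c -> reduced s ->
  cocycle_of_code (gap_code c) s = word_cocycle s c.
Proof.
move=> ac; elim: s => //= l s IH rs; rewrite IH ?(reduced_behead rs) //; congr (_ * _)%g.
have vs : cocycle (fg_eval s) c = word_cocycle s c.
  by rewrite /cocycle fg_eval_reduced // (reduced_behead rs).
have as' := cocycle_admissible s ac; have [_ _ c1] := as'.
have [eg eg' em em'] := admissible_line as'.
have lw : cocycle (fg_letter l * fg_eval s)%g c = (step l (recenter (word_cocycle s c) c) * word_cocycle s c)%g.
  by rewrite cocycleM // cocycle_letter vs.
case: l lw {rs} => i e; have [->|->|->] := I3P i => /= lw.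
- rewrite /step /=; case: e lw => lw; last by rewrite /gap_code invgK vs.
  rewrite {1}/gap_code invgK lw /step /= aline_recenterM.
  by have [_ ->] := gap_back eg' c1.
- by [].
rewrite !match_of_codeE // vs lw /step /=; set c' := recenter (word_cocycle s c) c.
rewrite -[in RHS]/(entry_step (ord_max, e) c'); congr (apow (- _%:Z) * _)%g => //.
rewrite -recenterM aline_recenterM.
have g0 : ~~ aline (recenter (entry_step (ord_max : 'I_3, e) c') c') 0.
  by rewrite /aline /recenter mul1g [c' _](entry_step_one e as').
have [_ gc' _] := as'; have [_ _ _ /(_ g0) H] := gc' (entry_step (ord_max : 'I_3, e) c').
by have [_ ->] := match_dual_back g0 H.
Qed.

End Decoding.

(** * Measurability and independence *)

Section CountableValued.
Context d (X : measurableType d).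

(** Measurability tested on points, which avoids putting sigma-algebras on the groups. *)
Definition countably_measurable (C : countType) (f : X -> C) : Prop :=
  forall c, measurable [set x | f x = c].

Lemma bigcup_countType_measurable (C : countType) (F : C -> set X) :
  (forall c, measurable (F c)) -> measurable (\bigcup_c F c).
Proof. by move=> mF; apply: countable_bigcupT_measurable. Qed.

Lemma bigcap_countType_measurable (C : countType) (F : C -> set X) :
  (forall c, measurable (F c)) -> measurable (\bigcap_c F c).
Proof.
move=> mF; rewrite -[X in measurable X]setCK setC_bigcap; apply: measurableC.
by apply: bigcup_countType_measurable => c; apply: measurableC.
Qed.

Lemma forall_measurable (C : countType) (F : C -> X -> Prop) :
  (forall c, measurable [set x | F c x]) -> measurable [set x | forall c, F c x].
Proof.
move=> mF; rewrite (_ : mkset _ = \bigcap_c [set x | F c x]).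
  exact: bigcap_countType_measurable.
by apply/seteqP; split=> x /= H c; [move=> _; exact: H|exact: H].
Qed.

Lemma exists_measurable (C : countType) (F : C -> X -> Prop) :
  (forall c, measurable [set x | F c x]) -> measurable [set x | exists c, F c x].
Proof.
move=> mF; rewrite (_ : mkset _ = \bigcup_c [set x | F c x]).
  exact: bigcup_countType_measurable.
by apply/seteqP; split=> x /= => [[c Fc]|[c _ Fc]]; exists c.
Qed.

Lemma countably_measurableP (C : countType) (f : X -> C) (P : set C) :
  countably_measurable f -> measurable [set x | P (f x)].
Proof.
move=> mf; rewrite (_ : mkset _ = [set x | exists c, P c /\ f x = c]).
  apply: exists_measurable => c; have [Pc|nPc] := pselect (P c).
    rewrite (_ : mkset _ = [set x | f x = c]); first exact: mf.
    by apply/seteqP; split=> x /= => [[]|].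
  rewrite (_ : mkset _ = set0); first exact: measurable0.
  by apply/seteqP; split=> x //= [].
by apply/seteqP; split=> x /= => [Pf|[c [Pc ->]]//]; exists (f x).
Qed.

Lemma countably_measurable_subst (C D : countType) (f : X -> C) (F : C -> X -> D) :
  countably_measurable f -> (forall c, countably_measurable (F c)) ->
  countably_measurable (fun x => F (f x) x).
Proof.
move=> mf mF e; rewrite (_ : mkset _ = [set x | exists c, f x = c /\ F c x = e]).
  by apply: exists_measurable => c; apply: measurableI; [exact: mf|exact: mF].
by apply/seteqP; split=> x /= => [<-|[c [<- ]]//]; exists (f x).
Qed.

Lemma countably_measurable_cst (C : countType) (c : C) :
  countably_measurable (fun=> c).
Proof.
move=> c'; have [->|ne] := eqVneq c c'.
  by rewrite (_ : mkset _ = setT)//; apply/seteqP; split.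
rewrite (_ : mkset _ = set0)//; apply/seteqP; split=> x //= /eqP.
by rewrite (negbTE ne).
Qed.

Lemma countably_measurable_comp (C D : countType) (f : X -> C) (h : C -> D) :
  countably_measurable f -> countably_measurable (h \o f).
Proof. by move=> mf e; exact: (@countably_measurableP _ f [set c | h c = e]). Qed.

Lemma countably_measurable_comp2 (C D E : countType) (f : X -> C) (g : X -> D)
    (h : C -> D -> E) : countably_measurable f -> countably_measurable g ->
  countably_measurable (fun x => h (f x) (g x)).
Proof.
move=> mf mg; apply: (@countably_measurable_subst _ _ f (fun c x => h c (g x))) => // c.
exact: (@countably_measurable_comp _ _ g (h c)).
Qed.

Lemma countably_measurable_bool (b : X -> bool) :
  measurable [set x | b x] -> countably_measurable b.
Proof.
move=> mb [//|]; rewrite (_ : mkset _ = ~` [set x | b x]); first exact: measurableC.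
by apply/seteqP; split=> x /=; case: (b x).
Qed.

Lemma countably_measurable_search (P : nat -> X -> bool) :
  (forall n, measurable [set x | P n x]) ->
  countably_measurable (fun x => search (fun n => P n x)).
Proof.
move=> mP n; rewrite (_ : mkset _ =
    [set x | (P n x /\ forall k, (k < n)%N -> ~~ P k x) \/
             (n = 0%N /\ forall k, ~~ P k x)]).
  have mN k : measurable [set x | ~~ P k x].
    rewrite (_ : mkset _ = ~` [set x | P k x]); first exact: measurableC.
    by apply/seteqP; split=> x /= /negP.
  have m1 : measurable [set x | forall k, (k < n)%N -> ~~ P k x].
    apply: forall_measurable => k; case: (k < n)%N.
      by rewrite (_ : mkset _ = [set x | ~~ P k x])//; apply/seteqP; split=> x //=; exact.
    by rewrite (_ : mkset _ = setT)//; apply/seteqP; split.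
  have m2 : measurable [set x | n = 0%N /\ forall k, ~~ P k x].
    have [->|n0] := eqVneq n 0%N.
      rewrite (_ : mkset _ = [set x | forall k, ~~ P k x]).
        by apply: forall_measurable => k; exact: mN.
      by apply/seteqP; split=> x /= => [[]|].
    rewrite (_ : mkset _ = set0)//; apply/seteqP; split=> x //= -[/eqP].
    by rewrite (negbTE n0).
  exact: measurableU (measurableI _ _ (mP n) m1) m2.
apply/seteqP; split=> x /=; last first.
  case=> [[Pn min]|[-> no]]; first exact: search_eq.
  by rewrite /search; case: pselect => // -[k Pk]; have := no k; rewrite Pk.
have [ex|no] := pselect (exists k, P k x).
  by move=> <-; left; exact: (searchP ex).
move=> <-; right; split; last by move=> k; apply/negP => Pk; apply: no; exists k.
by rewrite /search; case: pselect.
Qed.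

End CountableValued.

Section Partition.
Local Open Scope ereal_scope.
Context d d' (X : measurableType d) (X' : measurableType d') (R : realType).

(** Law of total probability: an identity of measures may be checked where a random vertex or gap is
    constant. *)
Lemma measure_partition_eq (C : countType)
    (mu : {measure set X -> \bar R}) (nu : {measure set X' -> \bar R})
    (A : set X) (B : set X') (f : X -> C) (g : X' -> C) (k : R) :
  (0 <= k)%R -> measurable A -> measurable B ->
  countably_measurable f -> countably_measurable g ->
  (forall c, mu (A `&` [set x | f x = c]) = k%:E * nu (B `&` [set x | g x = c])) ->
  mu A = k%:E * nu B.
Proof.
move=> k0 mA mB mf mg fg.
have dec d0 (Y : measurableType d0) (m : {measure set Y -> \bar R}) (D : set Y) (h : Y -> C) :
    measurable D -> countably_measurable h ->
    m D = \sum_(0 <= n <oo) m (D `&` [set x | choice.pickle (h x) = n]).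
  move=> mD mh; rewrite -measure_semi_bigcup //=.
  - congr (m _); apply/seteqP; split=> [x Dx|x [n _ []//]].
    by exists (choice.pickle (h x)).
  - move=> n; apply: measurableI => //.
    exact: (@countably_measurableP _ _ _ h [set c | choice.pickle c = n]).
  - by apply/trivIsetP => i j _ _ ij; apply/seteqP; split=> x //= [[_ e] [_ e']];
      rewrite -e -e' eqxx in ij.
  - apply: bigcup_measurable => n _; apply: measurableI => //.
    exact: (@countably_measurableP _ _ _ h [set c | choice.pickle c = n]).
rewrite (dec _ _ mu A f) // (dec _ _ nu B g) // -nneseriesZl //.
apply: eq_eseriesr => n _; case E : (@choice.pickle_inv C n) => [c|].
  have eqn (c' : C) : (choice.pickle c' = n) = (c' = c).
    apply/propext; split=> [cn|->]; last by have := @pickle_invK C n; rewrite E.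
    by move: E; rewrite -cn pickleK_inv => -[].
  have -> : [set x | choice.pickle (f x) = n] = [set x | f x = c] by apply/seteqP; split=> x /=; rewrite eqn.
  have -> : [set x | choice.pickle (g x) = n] = [set x | g x = c] by apply/seteqP; split=> x /=; rewrite eqn.
  exact: fg.
have none (c' : C) : choice.pickle c' <> n by move=> cn; move: E; rewrite -cn pickleK_inv.
have -> : [set x | choice.pickle (f x) = n] = set0 by apply/seteqP; split=> x //= /none.
have -> : [set x | choice.pickle (g x) = n] = set0 by apply/seteqP; split=> x //= /none.
by rewrite !setI0 !measure0 mule0.
Qed.

End Partition.

Section ProductSpaceMeasurability.
Context (I : choiceType) d (T : measurableType d).

Lemma measurable_coordinate (i : I) (A : set T) : measurable A ->
  measurable [set x : product_space I T | A (x i)].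
Proof. by move=> mA; apply: sub_sigma_algebra; exists i => //; exists A. Qed.

Lemma measurable_fun_product d' (Y : measurableType d') (f : Y -> product_space I T) :
  (forall i A, measurable A -> measurable [set y | A (f y i)]) ->
  measurable_fun setT f.
Proof.
move=> mf; apply: (@measurability _ _ Y (product_space I T) setT f (@coordinate_sets I d T) erefl).
by move=> _ [_ [i _ [A mA <-]] <-]; rewrite setTI; exact: mf.
Qed.

End ProductSpaceMeasurability.

Section AlmostEverywhere.
Local Open Scope ereal_scope.
Context d (X : measurableType d) (R : realType) (mu : {measure set X -> \bar R}).

Lemma measure_eq_on (A B H : set X) : measurable A -> measurable B -> measurable H ->
  mu (~` H) = 0 -> A `&` H = B `&` H -> mu A = mu B.
Proof.
move=> mA mB mH H0 AB.
have dec C : measurable C -> mu C = mu (C `&` H).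
  move=> mC; rewrite [mu C](measureDI mu mC mH) [X in X + _](_ : _ = 0) ?add0r //.
  apply: (@subset_measure0 _ _ _ mu _ (~` H) _ _ _ H0); last by move=> x [].
    exact: measurableD.
  exact: measurableC.
by rewrite dec // AB -dec.
Qed.

End AlmostEverywhere.

Section Conditioning.
Local Open Scope ereal_scope.
Context d (X : measurableType d) (R : realType) (mu : probability X R).
Context (A : set X) (mA : measurable A) (s : R).
Hypotheses (muA : mu A = s%:E) (s0 : (0 < s)%R).

(** The second [mu] is the default of [mnormalize] for mass 0 or infinity, excluded in
    [conditionedE] by [muA] and [s0]. *)
Definition conditioned : probability X R := mnormalize (mrestr mu mA) mu.

Lemma conditionedE B : conditioned B = mu (B `&` A) * s^-1%:E.
Proof.
by rewrite /conditioned /= /mnormalize /= /mrestr setTI muA eqe (gt_eqF s0).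
Qed.

End Conditioning.

(** * Conditional independence in a product space *)

Section Mixing.
Local Open Scope ereal_scope.
Context (I : choiceType) d (T : measurableType d) (R : realType).
Context (lam : probability T R) (mu : probability (product_space I T) R).
Hypothesis mu_product : is_product_measure lam mu.
Variable D : I -> bool.

Let X := product_space I T.

Definition mix (p : X * X) : X := fun i => if D i then p.2 i else p.1 i.

Lemma measurable_mix : measurable_fun setT mix.
Proof.
apply: measurable_fun_product => i A mA; rewrite /mix; case: (D i).
  have := @measurable_snd _ _ X X measurableT _ (measurable_coordinate i mA).
  by rewrite setTI.
have := @measurable_fst _ _ X X measurableT _ (measurable_coordinate i mA).
by rewrite setTI.
Qed.

Variables (e : I) (S : set T) (s : R).
Hypotheses (De : ~~ D e) (mS : measurable S) (lamS : lam S = s%:E) (s0 : (0 < s)%R).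

Let W : set (X * X) := [set p | S (p.2 e)].

Let mW : measurable W.
Proof.
have := @measurable_snd _ _ X X measurableT _ (measurable_coordinate e mS).
by rewrite setTI.
Qed.

Let pm : probability (X * X)%type R := (mu \x mu)%E.

Let mix_cylinder (J : {fset I}) (A : I -> set T) : (forall i, measurable (A i)) ->
  pm (W `&` mix @^-1` cylinder J A) = s%:E * \prod_(i <- J) lam (A i).
Proof.
move=> mA.
pose A1 i := if D i then setT else A i.
pose A2 i := if i == e then S else if D i then A i else setT.
have mA1 i : measurable (A1 i) by rewrite /A1; case: ifP.
have mA2 i : measurable (A2 i) by rewrite /A2; case: ifP => // _; case: ifP.
have -> : W `&` mix @^-1` cylinder J A = cylinder J A1 `*` cylinder (e |` (J `\ e))%fset A2.
  apply/seteqP; split=> [[x y] /= [Sy xy]|[x y] /= [Hx Hy]].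
    split=> i; rewrite /A1 /A2 /=.
      by move=> /xy; rewrite /mix /=; case: ifP.
    rewrite !inE; have [->//|ie /= iJ] := eqVneq i e.
    by move: (xy _ iJ); rewrite /mix /=; case: ifP.
  split; first by have := Hy e; rewrite !inE eqxx /A2 eqxx; exact.
  move=> i iJ; rewrite /mix /=; case: ifPn => iD; last first.
    by have := Hx i iJ; rewrite /A1 (negbTE iD).
  have ie : i != e by apply: contraTneq iD => ->.
  by have := Hy i; rewrite !inE iJ ie orbT /A2 (negbTE ie) iD; exact.
rewrite [pm _]product_measure1E; [|exact: measurable_cylinder..].
rewrite !mu_product // big_fsetU1 /=; last by rewrite !inE eqxx.
rewrite {1}/A2 eqxx lamS muleCA; congr (_ * _).
have -> : \prod_(i <- (J `\ e)%fset) lam (A2 i) =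
          \prod_(i <- J) lam (if D i then A i else setT).
  have [eJ|eJ] := boolP (e \in J).
    rewrite [RHS](big_fsetD1 e) //=. rewrite (negbTE De) [lam setT]probability_setT mul1e.
    rewrite big_seq_cond [RHS]big_seq_cond; apply: eq_bigr => i.
    by rewrite !inE andbT /A2 => /andP[/negbTE->].
  have -> : (J `\ e)%fset = J.
    by apply/fsetP => i; rewrite !inE; have [->|//] := eqVneq i e; rewrite (negbTE eJ).
  rewrite big_seq_cond [RHS]big_seq_cond; apply: eq_bigr => i /andP[iJ _].
  by rewrite /A2 ifN //; apply: contraNneq eJ => <-.
rewrite -big_split /=; apply: eq_bigr => i _; rewrite /A1.
by case: ifP => _; rewrite [lam setT]probability_setT ?mul1e ?mule1.
Qed.

(** The mixture takes the coordinate e from the first copy, so restricting the second copy at e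
    leaves its law unchanged. On cylinders the two copies separate. *)
Lemma mix_law (A : set X) : measurable A ->
  (mu \x mu) ([set p | S (p.2 e)] `&` mix @^-1` A) = s%:E * mu A.
Proof.
move=> mA; pose mix_mfun : {mfun (X * X)%type >-> X} :=
  HB.pack mix (isMeasurableFun.Build _ _ _ _ _ measurable_mix).
have pmW : pm W = s%:E.
  have := @mix_cylinder fset0 (fun=> setT) (fun=> measurableT).
  rewrite big_seq_fset0 mule1 => <-; congr (pm _).
  by apply/seteqP; split=> // x [].
pose P := conditioned pm mW.
have PE B : P B = pm (B `&` W) * s^-1%:E by exact: conditionedE.
have dE B : distribution P mix_mfun B = pm (W `&` mix @^-1` B) * s^-1%:E.
  by rewrite [W `&` _]setIC; exact: PE.
have prodP : is_product_measure lam (distribution P mix_mfun).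
  move=> J B mB; rewrite [LHS]dE mix_cylinder // muleC muleA -EFinM mulVf ?gt_eqF //.
  by rewrite mul1e.
have muE : distribution P mix_mfun A = mu A.
  exact: Defs.product_measure_unique prodP mu_product _ mA.
rewrite -muE dE.
by rewrite muleC -muleA -EFinM mulVf ?gt_eqF // mule1.
Qed.

End Mixing.

Section Independence.
Local Open Scope ereal_scope.
Context (I : choiceType) d (T : measurableType d) (R : realType).
Context (lam : probability T R) (mu : probability (product_space I T) R).
Hypothesis mu_product : is_product_measure lam mu.
Variable D : I -> bool.
Variables (e : I) (S : set T) (s : R).
Hypotheses (De : ~~ D e) (mS : measurable S) (lamS : lam S = s%:E) (s0 : (0 < s)%R).

Let X := product_space I T.
Local Notation mixD := (@mix I d T D).

(* Replace the coordinates of x in D by those of an independent copy x' with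
   x' e in S: the mixture has law mu, and it lies in E iff x does and in F iff
   x' does. *)
Lemma mix_independent (E F G : set X) :
  measurable E -> measurable F -> measurable G -> mu (~` G) = 0 ->
  E `<=` [set x | S (x e)] ->
  (forall x x', G x -> G x' -> (forall i, ~~ D i -> x i = x' i) -> E x -> E x') ->
  (forall x x', G x -> G x' -> (forall i, D i -> x i = x' i) ->
     S (x e) -> S (x' e) -> F x -> F x') ->
  F `<=` [set x | S (x e)] ->
  s%:E * mu (E `&` F) = mu E * mu F.
Proof.
move=> mE mF mG G0 ES Eoff Fon FS.
have mEF : measurable (E `&` F) by exact: measurableI.
have mmix B : measurable B -> measurable (mixD @^-1` B).
  by move=> mB; rewrite -[X in measurable X]setTI; exact: (@measurable_mix _ _ _ D).
have m1 B : measurable B -> measurable [set p : X * X | B p.1].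
  by move=> mB; have := @measurable_fst _ _ X X measurableT _ mB; rewrite setTI.
have m2 B : measurable B -> measurable [set p : X * X | B p.2].
  by move=> mB; have := @measurable_snd _ _ X X measurableT _ mB; rewrite setTI.
(* [Eoff] and [Fon] apply only within G, so both copies and the mixture are required to lie in G;
   each requirement excludes a null set. *)
pose H : set (X * X) := [set p | G p.1 /\ G p.2 /\ G (mixD p)].
have mH : measurable H by apply: measurableI; [exact: m1|apply: measurableI; [exact: m2|exact: mmix]].
have mW' : measurable [set p : X * X | S (p.2 e)] by exact: (m2 _ (measurable_coordinate e mS)).
have H0 : (mu \x mu) (~` H) = 0.
  have mGc := measurableC mG.
  rewrite (_ : ~` H = [set p | (~` G) p.1] `|` ([set p | (~` G) p.2] `|` mixD @^-1` (~` G))); last first.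
    by apply/seteqP; split=> p /=; rewrite /H /= !not_andP.
  have lT : lam setT = 1%:E by exact: probability_setT.
  have mix0 : (mu \x mu) (mixD @^-1` (~` G)) = 0.
    have := mix_law mu_product De measurableT lT ltr01 mGc.
    rewrite mul1e G0 => <-; congr ((mu \x mu) _).
    by apply/seteqP; split=> // x [].
  have m10 : (mu \x mu) [set p | (~` G) p.1] = 0.
    rewrite (_ : mkset _ = (~` G) `*` setT); last by apply/seteqP; split=> // x [].
    by rewrite product_measure1E // [X in X * _](_ : _ = 0) ?mul0e.
  have m20 : (mu \x mu) [set p | (~` G) p.2] = 0.
    rewrite (_ : mkset _ = setT `*` (~` G)); last by apply/seteqP; split=> // x [].
    by rewrite product_measure1E // [X in _ * X](_ : _ = 0) ?mule0.
  have n1 := m1 _ mGc; have n2 := m2 _ mGc; have n3 := mmix _ mGc.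
  by rewrite !measureU0 //; exact: measurableU.
rewrite -(mix_law mu_product De mS lamS s0) //.
have -> : mu E * mu F = (mu \x mu) (E `*` F) by rewrite product_measure1E.
apply: (@measure_eq_on _ _ _ _ _ _ H) => //.
- by apply: measurableI => //; exact: mmix.
- exact: measurableX.
apply/seteqP; split=> -[x y] /= [H1 [Gx [Gy Gm]]].
  case: H1 => Sy [Em Fm]; split => //.
  have off i : ~~ D i -> mixD (x, y) i = x i by rewrite /mix => /negbTE->.
  have on i : D i -> mixD (x, y) i = y i by rewrite /mix => ->.
  split; first exact: (Eoff (mixD (x, y)) x).
  by apply: (Fon (mixD (x, y)) y) => //; rewrite off //; have := Eoff _ _ Gm Gx off Em => /ES.
case: H1 => Ex Fy; split => //.
have off i : ~~ D i -> x i = mixD (x, y) i by rewrite /mix => /negbTE->.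
have on i : D i -> y i = mixD (x, y) i by rewrite /mix => ->.
split; first exact: FS.
split; first exact: (Eoff x (mixD (x, y))).
by apply: (Fon y (mixD (x, y))) => //; [exact: FS|rewrite -off //; exact: ES].
Qed.

End Independence.

(** * Measurability of gaps, matchings and cocycles *)

Section LineMeasurability.
Context d (Y : measurableType d).

Definition measurable_line (F : Y -> int -> bool) : Prop :=
  forall i, countably_measurable (fun y => F y i).

Lemma measurable_line_gap F : measurable_line F -> countably_measurable (fun y => gap (F y)).
Proof. by move=> mF; apply: countably_measurable_search => n; exact: mF. Qed.

Lemma measurable_line_height F r : measurable_line F ->
  countably_measurable (fun y => height (F y) r).
Proof.
move=> mF; elim: r => [|r IH].
  rewrite (_ : (fun _ => _) = (fun=> 0)); first exact: countably_measurable_cst.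
  by apply/funext => y; rewrite height0.
rewrite (_ : (fun _ => _) = (fun y => height (F y) r + (if F y r%:Z then 1 else -1))).
  apply: (@countably_measurable_comp2 _ _ _ _ _ _ _ (fun h (b : bool) => h + (if b then 1 else -1))) => //.
by apply/funext => y; rewrite heightS.
Qed.

Lemma measurable_line_match F : measurable_line F ->
  countably_measurable (fun y => match_dist (F y)).
Proof.
move=> mF; apply: countably_measurable_search => n.
have := countably_measurable_comp (fun h : int => h == 0) (measurable_line_height n.+1 mF).
exact.
Qed.

Lemma measurable_line_mirror F : measurable_line F -> measurable_line (fun y => mirror (F y)).
Proof. by move=> mF i; exact: mF. Qed.

Lemma measurable_line_dual F : measurable_line F -> measurable_line (fun y => dual (F y)).
Proof.
by move=> mF i; exact: (countably_measurable_comp negb (mF (- i))).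
Qed.

Lemma measurable_line_good F : measurable_line F -> measurable [set y | line_good (F y)].
Proof.
move=> mF.
have mH G j : measurable_line G -> measurable [set y | height (G y) j.+1 == 0].
  by move=> mG; exact: (@countably_measurableP _ _ _ _ [set h | h == 0] (measurable_line_height j.+1 mG)).
have m1 : measurable [set y | exists j : nat, F y j.+1%:Z].
  by apply: exists_measurable => j; exact: mF.
have m2 : measurable [set y | exists j : nat, F y (- j.+1%:Z)].
  by apply: exists_measurable => j; exact: mF.
have m3 : measurable [set y | F y 0 -> exists j, height (F y) j.+1 == 0].
  rewrite (_ : mkset _ = [set y | F y 0 = false] `|` [set y | exists j, height (F y) j.+1 == 0]).
    by apply: measurableU; [exact: mF|apply: exists_measurable => j; exact: mH].
  apply/seteqP; split=> y /=; first by case: (F y 0) => [H|_]; [right; exact: H|left].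
  by case=> [->//|].
have m4 : measurable [set y | ~~ F y 0 -> exists j, height (dual (F y)) j.+1 == 0].
  rewrite (_ : mkset _ = [set y | F y 0 = true] `|` [set y | exists j, height (dual (F y)) j.+1 == 0]).
    apply: measurableU; [exact: mF|apply: exists_measurable => j].
    exact: (mH (fun y => dual (F y)) j (measurable_line_dual mF)).
  apply/seteqP; split=> y /=; first by case: (F y 0) => [_|H]; [left|right; exact: H].
  by case=> [->//|].
rewrite (_ : mkset _ = [set y | exists j : nat, F y j.+1%:Z] `&`
  ([set y | exists j : nat, F y (- j.+1%:Z)] `&`
  ([set y | F y 0 -> exists j, height (F y) j.+1 == 0] `&`
   [set y | ~~ F y 0 -> exists j, height (dual (F y)) j.+1 == 0]))).
  by do 3![apply: measurableI => //].
by apply/seteqP; split=> y /= => [[]|[? [? []]]].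
Qed.

Definition measurable_coloring (C : Y -> coloring) : Prop :=
  forall h, countably_measurable (fun y => C y h).

Lemma measurable_coloring_recenter C g : measurable_coloring C ->
  measurable_coloring (fun y => recenter g (C y)).
Proof. by move=> mC h; exact: mC. Qed.

Lemma measurable_coloring_line C g : measurable_coloring C ->
  measurable_line (fun y => aline (recenter g (C y))).
Proof. by move=> mC i; exact: mC. Qed.

Lemma measurable_entry_step C l g : measurable_coloring C ->
  countably_measurable (fun y => entry_step l (recenter g (C y))).
Proof.
move=> mC; rewrite /entry_step; case: (l.1 == 1%N :> nat); first exact: countably_measurable_cst.
apply: (@countably_measurable_comp _ _ _ _ _ (fun m : nat => (blet l.2 * apow m%:Z)%g)).
by apply/measurable_line_match/measurable_coloring_line.
Qed.

Lemma measurable_step C l g : measurable_coloring C ->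
  countably_measurable (fun y => step l (recenter g (C y))).
Proof.
move=> mC; have mL := measurable_coloring_line _ mC; rewrite /step.
case: (l.1 == 0%N :> nat).
  case: (l.2).
    apply: (@countably_measurable_comp _ _ _ _ _ (fun n : nat => apow (- n.+1%:Z))).
    exact/measurable_line_gap/measurable_line_mirror.
  apply: (@countably_measurable_comp _ _ _ _ _ (fun n : nat => apow n.+1%:Z)).
  exact/measurable_line_gap.
case: (l.1 == 1%N :> nat); first exact: measurable_entry_step.
apply: (@countably_measurable_subst _ _ _ _ (fun y => entry_step l (recenter g (C y)))
  (fun h y => (apow (- (match_dist (dual (aline (recenter h (recenter g (C y))))))%:Z) * h)%g)).
  exact: measurable_entry_step.
move=> h; apply: (@countably_measurable_comp _ _ _ _ _ (fun m : nat => (apow (- m%:Z) * h)%g)).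
apply: measurable_line_match; apply: measurable_line_dual.
exact/measurable_coloring_line/measurable_coloring_recenter.
Qed.

Lemma measurable_word_cocycle C s : measurable_coloring C ->
  countably_measurable (fun y => word_cocycle s (C y)).
Proof.
move=> mC; elim: s => [|l s IH] /=; first exact: countably_measurable_cst.
apply: (@countably_measurable_subst _ _ _ _ (fun y => word_cocycle s (C y))
  (fun g y => (step l (recenter g (C y)) * g)%g)) => // g /=.
apply: (@countably_measurable_comp _ _ _ _ (fun y => step l (recenter g (C y))) (fun h => (h * g)%g)).
exact: measurable_step.
Qed.

Lemma measurable_entry C s : measurable_coloring C ->
  countably_measurable (fun y => entry s (C y)).
Proof.
move=> mC; rewrite /entry; case: (strip _ _) => [|l t]; first exact: countably_measurable_cst.
apply: (@countably_measurable_subst _ _ _ _ (fun y => word_cocycle t (C y))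
  (fun g y => (entry_step l (recenter g (C y)) * g)%g)).
  exact: measurable_word_cocycle.
move=> g /=; apply: (@countably_measurable_comp _ _ _ _ (fun y => entry_step l (recenter g (C y))) (fun h => (h * g)%g)).
exact: measurable_entry_step.
Qed.

Lemma measurable_good C : measurable_coloring C -> measurable [set y | good (C y)].
Proof.
move=> mC; apply: forall_measurable => g.
exact/measurable_line_good/measurable_coloring_line.
Qed.

Lemma measurable_gap_code C w : measurable_coloring C ->
  countably_measurable (fun y => gap_code (C y) w).
Proof.
move=> mC; apply: (@countably_measurable_subst _ _ _ _ (fun y => cocycle w^-1%g (C y))
  (fun g y => gap (aline (recenter g (C y))))).
  exact: measurable_word_cocycle.
by move=> g; exact/measurable_line_gap/measurable_coloring_line.
Qed.

Lemma measurable_match_of_code (Z : Y -> F3 -> nat) w :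
  (forall v, countably_measurable (fun y => Z y v)) ->
  countably_measurable (fun y => match_of_code (Z y) w).
Proof.
move=> mZ; apply: measurable_line_match => i; apply: countably_measurable_bool.
rewrite (_ : mkset _ = [set y | exists k : nat,
    zero_pos (fun k => Z y (cpow k%:Z * w)^-1%g) k = `|i|%N]); last first.
  by apply/seteqP; split=> y /= /asboolP.
apply: exists_measurable => k.
suff : countably_measurable (fun y => zero_pos (fun k => Z y (cpow k%:Z * w)^-1%g) k) by exact.
elim: k => [|k IH].
  rewrite (_ : (fun _ => _) = (fun=> 0%N)); first exact: countably_measurable_cst.
  by apply/funext => y; rewrite /zero_pos big_ord0.
rewrite (_ : (fun _ => _) = (fun y => (zero_pos (fun k => Z y (cpow k%:Z * w)^-1%g) k
    + (Z y (cpow k%:Z * w)^-1%g).+1)%N)); last first.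
  by apply/funext => y; rewrite /zero_pos big_ord_recr.
exact: (@countably_measurable_comp2 _ _ _ _ _ _ _ (fun a b => (a + b.+1)%N)).
Qed.

Lemma measurable_cocycle_of_code (Z : Y -> F3 -> nat) s :
  (forall v, countably_measurable (fun y => Z y v)) ->
  countably_measurable (fun y => cocycle_of_code (Z y) s).
Proof.
move=> mZ; elim: s => [|l s IH] /=; first exact: countably_measurable_cst.
apply: (@countably_measurable_comp2 _ _ _ _ _ _ _ (fun g h : F2 => (g * h)%g)) => //.
case: (l.1 == 0%N :> nat).
  case: (l.2).
    exact: (@countably_measurable_comp _ _ _ _ _ (fun n : nat => apow (- n.+1%:Z))).
  exact: (@countably_measurable_comp _ _ _ _ _ (fun n : nat => apow n.+1%:Z)).
case: (l.1 == 1%N :> nat); first exact: countably_measurable_cst.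
by apply: (@countably_measurable_comp2 _ _ _ _ _ _ _ (fun m m' : nat =>
  (apow (- m%:Z) * (blet l.2 * apow m'%:Z))%g)); exact: measurable_match_of_code.
Qed.

End LineMeasurability.

(** * The coset shift *)

Notation bgroup := (cyclic_subgroup (@fg_gen 2 ord_max)).
Notation coset_space := (product_space (left_cosets bgroup) 'Z_2).

Section Cosets.
Implicit Types g h : F2.

Definition coset_of_b g : left_cosets bgroup :=
  SigSub (mem_set (ex_intro2 _ _ g I erefl : left_cosets bgroup (left_translate g bgroup))).

Lemma coset_translate_of_b g h : coset_translate g (coset_of_b h) = coset_of_b (g * h)%g.
Proof. by apply/val_inj; rewrite /= left_translateM. Qed.

Lemma coset_of_b_onto (C : left_cosets bgroup) : exists g, C = coset_of_b g.
Proof.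
by have [g _ gC] := set_mem (valP C); exists g; apply/val_inj; rewrite /= gC.
Qed.

Lemma bgroupE g : bgroup g <-> exists j, g = zexpg (blet false) j.
Proof.
split=> [[k [->|->]]|[[k|k] ->]].
- by exists k%:Z.
- by exists (- k%:Z); rewrite zexpgN.
- by exists k; left.
- by exists k.+1; right; rewrite /= -expVgn.
Qed.

Lemma coset_of_b_eq g h : coset_of_b g = coset_of_b h -> exists j, h = (g * zexpg (blet false) j)%g.
Proof.
move=> /(congr1 val) /= gh; have : left_translate g bgroup h.
  by rewrite gh; exists 1%g; rewrite ?mulg1//; apply/bgroupE; exists 0.
by case=> a /bgroupE[j ->] <-; exists j.
Qed.

Lemma coset_of_bM g j : coset_of_b (g * zexpg (blet false) j)%g = coset_of_b g.
Proof.
apply/val_inj; rewrite /= left_translateM; congr left_translate.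
apply/seteqP; split=> [_ [_ /bgroupE[k ->] <-]|_ /bgroupE[k ->]].
  by apply/bgroupE; exists (j + k); rewrite zexpgD.
exists (zexpg (blet false) (k - j)); first by apply/bgroupE; exists (k - j).
by rewrite -zexpgD addrC subrK.
Qed.

(* The vertex h stands for the point h x of the orbit of x, whose value at the
   trivial coset is the value of x at the coset of h^-1. *)
Definition colour (x : coset_space) : coloring := fun h => x (coset_of_b h^-1%g) == 0.

Lemma colour_b_invariant x : b_invariant (colour x).
Proof. by move=> h; rewrite /colour invgM -(zexpg1 (blet false)) -zexpgN coset_of_bM. Qed.

Lemma colour_eq x x' h : colour x h = colour x' h -> x (coset_of_b h^-1%g) = x' (coset_of_b h^-1%g).
Proof.
rewrite /colour; case: (x _) => -[|[|//]] i; case: (x' _) => -[|[|//]] i' //= _; exact/val_inj.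
Qed.

Lemma colour_inj : injective colour.
Proof.
move=> x x' e; apply/funext => C; have [g ->] := coset_of_b_onto C.
by have := @colour_eq x x' g^-1%g; rewrite invgK; apply; rewrite e.
Qed.

Lemma measurable_colour : measurable_coloring colour.
Proof.
move=> h b; rewrite /colour.
exact: (@measurable_coordinate _ _ 'Z_2 (coset_of_b h^-1%g) [set t | (t == 0) = b]).
Qed.

End Cosets.

(** * Independence of the colours *)

Section Measure.
Context (R : realType) (mu : probability coset_space R).
Hypothesis mu_product : is_product_measure (uniform_Z2 R) mu.
Local Open Scope ereal_scope.

Local Notation T := (coset_shift mu_product).

Lemma colour_shift g x : colour (T g x) = recenter g (colour x).
Proof.
apply/funext => h; rewrite /colour /recenter invgM -coset_translate_of_b.
by [].
Qed.

Lemma mu_preimage g A : measurable A -> mu (T g @^-1` A) = mu A.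
Proof. exact: pmp_act_preserving. Qed.

Lemma measurable_preimage g A : measurable A -> measurable (T g @^-1` A).
Proof.
by move=> mA; rewrite -[X in measurable X]setTI; exact: pmp_act_measurable.
Qed.

Lemma uniform_half b : uniform_Z2 R [set t : 'Z_2 | (t == 0%R) = b] = (2^-1)%:E.
Proof.
rewrite /uniform_Z2 /mscale (_ : Measure.sort _ _ = 1) ?mule1 //.
have inE' (t : 'Z_2) : (t \in [set t : 'Z_2 | (t == 0%R) = b]) = ((t == 0%R) == b).
  by apply/idP/eqP; rewrite inE.
rewrite [LHS]measure_addE /= !diracE !inE' -EFinD.
by case: b {inE'}; rewrite ?addr0 ?add0r.
Qed.

Lemma mu_bit b : mu [set x | colour x 1%g = b] = (2^-1)%:E.
Proof.
pose A (i : left_cosets bgroup) := [set t : 'Z_2 | (t == 0%R) = b].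
have <- : mu (cylinder [fset coset_of_b 1^-1%g]%fset A) = (2^-1)%:E.
  by rewrite mu_product // big_seq_fset1; exact: uniform_half.
congr (mu _); apply/seteqP; split=> x.
  by move=> xb i; rewrite inE => /eqP ->.
by move=> /(_ (coset_of_b 1^-1%g)); rewrite inE eqxx; exact.
Qed.

Definition good_set : set coset_space := [set x | good (colour x)].

Lemma measurable_good_set : measurable good_set.
Proof. exact: (measurable_good measurable_colour). Qed.

Let cosets_of (P : set F2) (C : left_cosets bgroup) : bool :=
  `[< exists2 h, P h & C = coset_of_b h^-1%g >].

Let cosets_ofN P h : (forall h j, P h -> P (zexpg (blet false) j * h)%g) ->
  ~ P h -> ~~ cosets_of P (coset_of_b h^-1%g).
Proof.
move=> bP nP; apply/asboolPn => -[h' Ph' /esym/coset_of_b_eq[j E]]; apply: nP.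
by rewrite -[h]invgK E invgM invgK -zexpgN; exact: bP.
Qed.

(** Since P is invariant under b, the colours inside and outside P are functions of disjoint sets of
    cosets. *)
Lemma colour_independent (P : set F2) (E F : set coset_space) :
  (forall h j, P h -> P (zexpg (blet false) j * h)%g) -> ~ P 1%g ->
  measurable E -> measurable F ->
  (forall x x', (forall h, ~ P h -> colour x h = colour x' h) -> E x -> E x') ->
  (forall x x', (forall h, P h -> colour x h = colour x' h) -> F x -> F x') ->
  mu (E `&` F) = mu E * mu F.
Proof.
move=> bP P1 mE mF Eoff Fon.
have D1 := cosets_ofN bP P1.
have := @mix_independent _ _ _ _ _ _ mu_product (cosets_of P) (coset_of_b 1^-1%g) setT 1%R D1
  measurableT (probability_setT _) ltr01 E F setT mE mF measurableT _ _ _ _ _.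
rewrite mul1e; apply=> //; first by rewrite setCT measure0.
- move=> x x' _ _ off; apply: Eoff => h nP.
  by rewrite /colour off //; exact: cosets_ofN.
- move=> x x' _ _ on _ _; apply: Fon => h Ph.
  by rewrite /colour on //; apply/asboolP; exists h.
Qed.

(** Independence given the bit at e, which both events may read; 2 is the inverse of its
    probability. *)
Lemma colour_independent_given (P : set F2) (e : F2) (b : bool) (E F : set coset_space) :
  mu (~` good_set) = 0 ->
  (forall h j, P h -> P (zexpg (blet false) j * h)%g) -> ~ P e ->
  measurable E -> measurable F ->
  E `<=` [set x | colour x e = b] -> F `<=` [set x | colour x e = b] ->
  (forall x x', good_set x -> good_set x' ->
     (forall h, ~ P h -> colour x h = colour x' h) -> E x -> E x') ->
  (forall x x', good_set x -> good_set x' ->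
     (forall h, P h -> colour x h = colour x' h) -> colour x e = colour x' e ->
     F x -> F x') ->
  mu (E `&` F) = 2%:E * (mu E * mu F).
Proof.
move=> G0 bP Pe mE mF Eb Fb Eoff Fon.
have De := cosets_ofN bP Pe.
rewrite -(@mix_independent _ _ _ _ _ _ mu_product (cosets_of P) (coset_of_b e^-1%g)
  [set t : 'Z_2 | (t == 0%R) = b] (2^-1)%R De _ (uniform_half b) _ E F good_set) //.
- by rewrite muleA -EFinM divff ?mul1e.
- exact: measurable_good_set.
- move=> x x' Gx Gx' off; apply: Eoff => // h nP.
  by rewrite /colour off //; exact: cosets_ofN.
- move=> x x' Gx Gx' on xb xb'; apply: Fon => // [h Ph|].
    by rewrite /colour on //; apply/asboolP; exists h.
  by move: xb xb'; rewrite /colour /= => -> ->.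
Qed.

End Measure.

(** * Almost sure existence of the matching *)

Section Survival.
Implicit Types (f : int -> bool) (h : int).

(** The direction d and the exchange s give four walks, so that one estimate covers every clause of
    [line_good]. *)
Definition variant (d s : bool) f : int -> bool :=
  fun i => f (if d then - i else i) (+) s.

Definition survives h f : Prop := forall r, 0 < h + height f r.

Lemma height_translate f r :
  height f r.+1 = (if f 0 then 1 else -1) + height (translate 1 f) r.
Proof.
rewrite /height big_ord_recl; congr (_ + _); apply: eq_bigr => i _.
by rewrite /translate lift0 intS addrC.
Qed.

Lemma eq_survives h f g : (forall i : nat, f i%:Z = g i%:Z) -> survives h f -> survives h g.
Proof. by move=> fg hf r; rewrite -(@eq_height f) // => i _; exact: fg. Qed.

Lemma survivesE h f : survives h f <->
  0 < h /\ survives (h + (if f 0 then 1 else -1)) (translate 1 f).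
Proof.
split=> [hf|[h0 hf] [|r]].
- split; first by have := hf 0%N; rewrite height0 addr0.
  by move=> r; have := hf r.+1; rewrite height_translate addrA.
- by rewrite height0 addr0.
- by rewrite height_translate addrA.
Qed.

Lemma translate_variant d s f :
  translate 1 (variant d s f) = variant d s (translate (if d then -1 else 1) f).
Proof.
by apply/funext => i; rewrite /translate /variant; case: d; rewrite // opprD.
Qed.

Lemma dual_variant f : dual f = variant true true f.
Proof. by apply/funext => i; rewrite /variant addbT. Qed.

Lemma survives_unmatched f : f 0 -> (forall j, height f j.+1 != 0) ->
  survives 1 (translate 1 f).
Proof.
move=> f0 nz; suff H r : 0 < height f r.+1.
  by move=> r; have := H r; rewrite height_translate f0.
elim: r => [|r IH]; first by rewrite heightS height0 f0.
by have := nz r.+1; rewrite heightS; case: ifP => _; lia.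
Qed.

Lemma survives_constant f : (forall j : nat, f j.+1%:Z) -> survives 1 (translate 1 f).
Proof.
move=> ft r; elim: r => [|r IH]; first by rewrite height0.
by have := ft r; rewrite intS addrC -/(translate 1 f r) heightS => ->; lia.
Qed.

(** If zeros are missing on one side, the line is constant there; if 0 is unmatched, its walk stays
    positive. In each case one of the walks survives from height 1. *)
Lemma line_bad f : ~ line_good f -> exists d s, survives 1 (translate 1 (variant d s f)).
Proof.
move=> bad; apply: contrapT => none; apply: bad.
have {}none d s : ~ survives 1 (translate 1 (variant d s f)).
  by move=> H; apply: none; exists d, s.
have some (P : pred nat) : ~ (forall j, ~~ P j) -> exists j, P j.
  by move=> H; apply: contrapT => no; apply: H => j; apply/negP => Pj; apply: no; exists j.
split.
- apply: (some (fun j => f j.+1%:Z)) => no; apply: (none false true).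
  by apply: survives_constant => j; rewrite /variant addbT.
- apply: (some (fun j => f (- j.+1%:Z))) => no; apply: (none true true).
  by apply: survives_constant => j; rewrite /variant addbT.
- move=> f0; apply: some => no; apply: (none false false).
  rewrite (_ : variant false false f = f); first exact: survives_unmatched.
  by apply/funext => i; rewrite /variant addbF.
- move=> f0; apply: some => no; apply: (none true true).
  by rewrite -dual_variant; apply: survives_unmatched => //; rewrite /dual oppr0.
Qed.

End Survival.

Section NullSet.
Context (R : realType) (mu : probability coset_space R).
Hypothesis mu_product : is_product_measure (uniform_Z2 R) mu.
Local Open Scope ereal_scope.

Local Notation T := (coset_shift mu_product).

Section Walk.
Variables d s : bool.

Let E (h : int) : set coset_space := [set x | survives h (variant d s (aline (colour x)))].

Let mE h : measurable (E h).
Proof.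
apply: forall_measurable => r.
have mF : measurable_line (fun x => variant d s (aline (colour x))).
  move=> i; apply: (@countably_measurable_comp _ _ _ _ (fun x => colour x (apow (if d then - i else i)%R)) (addb^~ s)).
  exact: measurable_colour.
exact: (@countably_measurable_comp _ _ _ _ _ (fun k : int => (0 < h + k)%R) (measurable_line_height r mF) true).
Qed.

Let g : F2 := apow (if d then -1 else 1)%R.

Let Eg h : T g @^-1` E h = [set x | survives h (translate 1 (variant d s (aline (colour x))))].
Proof.
apply/seteqP; split=> x; rewrite /E /= (colour_shift mu_product) aline_recenter translate_variant //.
Qed.

Let bit b : set coset_space := [set x | colour x 1%g = b].

Let mbit b : measurable (bit b).
Proof. exact: measurable_colour. Qed.

(** The first bit and the rest of the walk use disjoint sets of cosets, and the rest is a shifted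
    copy of the walk. *)
Let step_measure b h : mu (bit b `&` T g @^-1` E h) = (2^-1)%:E * mu (E h).
Proof.
rewrite (@colour_independent _ _ mu_product (branch 1%g)).
- by rewrite (mu_bit mu_product) (mu_preimage mu_product).
- by move=> k j; exact: branch_b.
- exact: branch_irrefl1.
- exact: mbit.
- exact: measurable_preimage.
- by move=> x x' xx'; rewrite /bit /= xx' //; exact: branch_irrefl1.
move=> x x' xx'; rewrite !Eg /=; apply: eq_survives => i.
rewrite /translate /variant /aline xx' //; exists 0%R, (if d then - (i%:Z + 1) else i%:Z + 1)%R.
by rewrite zexpg0 mul1g mulg1; split=> //; case: d; rewrite ?oppr_eq0.
Qed.

Let q (n : nat) : R := fine (mu (E n%:Z)).

Let qE n : mu (E n%:Z) = (q n)%:E.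
Proof. by rewrite /q fineK // fin_num_measure. Qed.

Let q0 : q 0 = 0%R.
Proof.
rewrite /q (_ : E 0 = set0) ?measure0 //; apply/seteqP; split=> x //.
by move=> /(_ 0%N); rewrite height0 addr0 ltxx.
Qed.

Let q_le1 n : (q n <= 1)%R.
Proof. by rewrite -lee_fin -qE probability_le1. Qed.

Let q_ge0 n : (0 <= q n)%R.
Proof. by rewrite -lee_fin -qE. Qed.

Let q_harmonic n : (q n.+2 = 2 * q n.+1 - q n)%R.
Proof.
(* The colour of the starting vertex for which the walk goes up. *)
pose b := ~~ s.
have dec : E n.+1%:Z = (bit b `&` T g @^-1` E n.+2%:Z) `|` (bit (~~ b) `&` T g @^-1` E n%:Z).
  rewrite !Eg; apply/seteqP; split=> x.
    move=> /survivesE[_]; rewrite {1}/variant /= oppr0 if_same /b /bit /= /aline.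
    case e : (_ (+) _) => H; [left|right]; split=> //.
    - by move: e; case: (colour x _); case: (s).
    - by rewrite -addn1 PoszD.
    - by move: e; case: (colour x _); case: (s).
    - by move: H; rewrite -addn1 PoszD addrK.
  have v0 : variant d s (aline (colour x)) 0 = colour x 1%g (+) s.
    by rewrite /variant oppr0 if_same.
  move=> [[xb Hx]|[xb Hx]]; apply/survivesE; split => //; rewrite v0.
    by rewrite (_ : _ (+) _ = true) -?PoszD ?addn1 //; rewrite [colour x _]xb /b; case: (s).
  rewrite (_ : _ (+) _ = false); first by rewrite -addn1 PoszD addrK.
  by rewrite [colour x _]xb /b; case: (s).
have add : mu (E n.+1%:Z) = mu (bit b `&` T g @^-1` E n.+2%:Z) + mu (bit (~~ b) `&` T g @^-1` E n%:Z).
  rewrite dec measureU //.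
  - by apply: measurableI; [exact: mbit|exact: measurable_preimage].
  - by apply: measurableI; [exact: mbit|exact: measurable_preimage].
  - by apply/seteqP; split=> x // [[xb _] [xb' _]]; move: xb xb'; rewrite /bit /= => ->; case: (b).
move: add; rewrite !step_measure !qE -!EFinM -EFinD => -[->].
by rewrite mulrDr !mulrA divff // !mul1r addrK.
Qed.

Lemma walk_null : mu (T g @^-1` E 1) = 0.
Proof.
rewrite mu_preimage // (qE 1); congr EFin.
have qn n : q n = (n%:R * q 1)%R /\ q n.+1 = (n.+1%:R * q 1)%R.
  elim: n => [|n [IH1 IH2]]; first by rewrite q0 mul0r mul1r.
  split=> //; rewrite q_harmonic IH1 IH2 mulrA -mulrBl; congr (_ * _)%R.
  by rewrite -!natr1; lra.
apply/eqP; rewrite eq_le q_ge0 andbT leNgt; apply/negP => q1.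
have := archi_boundP (ltW (divr_gt0 ltr01 q1)); set n := Num.bound _.
rewrite ltr_pdivrMr // ltNge => /negP; apply.
by rewrite -(qn n).1; exact: q_le1.
Qed.

End Walk.

Lemma mu_good_set : mu (~` good_set) = 0.
Proof.
pose t (d : bool) : F2 := apow (if d then -1 else 1)%R.
pose E (d s : bool) : set coset_space :=
  [set x | survives 1 (variant d s (aline (colour x)))].
(* The exceptional set is covered by countably many null sets, indexed by vertex, direction and
   exchange. *)
pose N (p : F2 * bool * bool) := T p.1.1 @^-1` (T (t p.1.2) @^-1` E p.1.2 p.2).
have mN p : measurable (T (t p.1.2) @^-1` E p.1.2 p.2).
  apply: measurable_preimage; apply: forall_measurable => r.
  apply: (@countably_measurable_comp _ _ _ _ _ (fun k : int => (0 < 1 + k)%R)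
    (measurable_line_height r _) true) => i.
  apply: (@countably_measurable_comp _ _ _ _ (fun x => colour x (apow (if p.1.2 then - i else i)%R)) (addb^~ p.2)).
  exact: measurable_colour.
have N0 p : mu (N p) = 0.
  by rewrite mu_preimage //; exact: walk_null.
pose F n := if @choice.pickle_inv (F2 * bool * bool)%type n is Some p then N p else set0.
apply: measure_negligible; first by apply: measurableC; exact: measurable_good_set.
apply: (@negligibleS _ _ _ _ (\bigcup_n F n)); last first.
  apply: negligible_bigcup => n; rewrite /F; case: (choice.pickle_inv n) => [p|].
    by apply/negligibleP; [exact: measurable_preimage|exact: N0].
  exact: negligible_set0.
move=> x /existsNP[g /line_bad[d [s H]]].
exists (choice.pickle (g, d, s)) => //; rewrite /F choice.pickleK_inv /N /E /=.
by rewrite !(colour_shift mu_product) aline_recenter -translate_variant.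
Qed.

End NullSet.

(** * The law of the gaps *)

(** The label without the inverse of [gap_code], so that it follows the cocycle identity
    directly. *)
Definition gap_at (w : F3) (c : coloring) : nat := gap (aline (recenter (cocycle w c) c)).

Lemma gap_atM w w' c : admissible c ->
  gap_at (w * w')%g c = gap_at w (recenter (cocycle w' c) c).
Proof. by move=> ac; rewrite /gap_at cocycleM // recenterM. Qed.

Lemma gap_at1 c : gap_at 1%g c = gap (aline c).
Proof. by rewrite /gap_at cocycle1 recenter1. Qed.

Lemma gap_at_line k c c' : aline c = aline c' -> gap_at (cpow k) c = gap_at (cpow k) c'.
Proof.
by move=> cc'; rewrite /gap_at; have [E1 E2] := cpow_cocycle_line k cc'; rewrite -E1 E2.
Qed.

Lemma gap_at_nat (k : nat) c c' : (forall i : nat, aline c i%:Z = aline c' i%:Z) ->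
  gap_at (cpow k%:Z) c = gap_at (cpow k%:Z) c'.
Proof.
move=> cc'; rewrite /gap_at; have [<- [m ->]] := cpow_cocycle_nat k cc'.
by rewrite !aline_recenter; apply: eq_gap => i; rewrite /translate -PoszD.
Qed.

Lemma measurable_gap_at d (Y : measurableType d) (C : Y -> coloring) w :
  measurable_coloring C -> countably_measurable (fun y => gap_at w (C y)).
Proof. by move=> mC; have := measurable_gap_code w^-1%g mC; rewrite /gap_code invgK. Qed.

Lemma strip_apow i : strip ord_max (val (apow i)) = val (apow i).
Proof. by rewrite -[apow i]mulg1 /apow val_zexp //; case: `|i|%N. Qed.

Lemma b_apow_inj j j' i i' :
  (zexpg (blet false) j * apow i)%g = (zexpg (blet false) j' * apow i')%g -> i = i'.
Proof.
move=> /(zexp_letter_inj (strip_apow i) (strip_apow i'))[_].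
rewrite -[apow i]mulg1 -[apow i']mulg1 => e.
by have [] := @zexp_letter_inj 2 ord0 i i' 1%g 1%g erefl erefl e.
Qed.

(** * Independence of the gaps along one line *)

Section LineLaw.
Context (R : realType) (mu : probability coset_space R).
Hypothesis mu_product : is_product_measure (uniform_Z2 R) mu.
Local Open Scope ereal_scope.

Local Notation T := (coset_shift mu_product).
Local Notation X := coset_space.

Definition admissible_set : set X := [set x | admissible (colour x)].

Lemma measurable_admissible_set : measurable admissible_set.
Proof.
rewrite (_ : admissible_set = good_set `&` [set x | colour x 1%g = true]).
  by apply: measurableI; [exact: measurable_good_set|exact: measurable_colour].
apply/seteqP; split=> x; first by case.
by case=> gx cx; split=> //; exact: colour_b_invariant.
Qed.

Lemma mu_admissible_set : mu admissible_set = (2^-1)%:E.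
Proof.
rewrite -(mu_bit mu_product true); apply: (measure_eq_on measurable_admissible_set _
  measurable_good_set (mu_good_set mu_product)); first exact: measurable_colour.
apply/seteqP; split=> x; first by case=> -[].
by case=> cx gx; split=> //; split=> //; exact: colour_b_invariant.
Qed.

(** An invertible map that moves points within their orbits preserves the measure: where s is
    constant it is a single group element, and u recovers s at the image. *)
Lemma piecewise_preserving (s u : X -> F2) (P P' B : set X) :
  countably_measurable s -> countably_measurable u ->
  measurable P -> measurable P' -> measurable B ->
  (forall x, P x -> P' (T (s x) x) /\ u (T (s x) x) = s x) ->
  (forall z, P' z -> P (T (u z)^-1%g z) /\ s (T (u z)^-1%g z) = u z) ->
  mu (P `&` [set x | B (T (s x) x)]) = mu (P' `&` B).
Proof.
move=> ms mu' mP mP' mB sP uP.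
have mBs : measurable [set x | B (T (s x) x)].
  rewrite (_ : mkset _ = [set x | exists g, s x = g /\ B (T g x)]).
    by apply: exists_measurable => g; apply: measurableI; [exact: ms|exact: measurable_preimage].
  by apply/seteqP; split=> x /= => [Bx|[g [<-]]//]; exists (s x).
rewrite -[RHS]mul1e; apply: (@measure_partition_eq _ _ _ _ _ _ mu mu _ _ s u 1%R) => //.
- exact: measurableI.
- exact: measurableI.
move=> g; rewrite mul1e; transitivity (mu (T g @^-1` (P' `&` B `&` [set z | u z = g]))); last first.
  by apply: mu_preimage; apply: measurableI; [exact: measurableI|exact: mu'].
congr (mu _); apply/seteqP; split=> x /=.
  by move=> [[Px Bx] sg]; have [P'x ux] := sP x Px; rewrite -!sg.
move=> [[P'x Bx] ug]; have := uP _ P'x; rewrite ug -pmp_actM mulVg pmp_act1 => -[Px sx].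
by rewrite sx.
Qed.

Lemma measurable_gap1 : measurable_fun setT (fun x : X => gap_at 1%g (colour x)).
Proof.
move=> _ B _; rewrite setTI.
exact: (@countably_measurableP _ _ _ _ B (measurable_gap_at 1%g measurable_colour)).
Qed.

Definition first_gap : {mfun X >-> nat} :=
  HB.pack (fun x : X => gap_at 1%g (colour x))
    (isMeasurableFun.Build _ _ _ _ _ measurable_gap1).

Definition first_gap_law : probability nat R :=
  distribution (conditioned mu measurable_admissible_set) first_gap.

Local Notation lam := first_gap_law.

Lemma inv2_gt0 : (0 < 2^-1 :> R)%R.
Proof. by rewrite invr_gt0. Qed.

Lemma mu_gap B :
  mu (admissible_set `&` [set x | B (gap_at 1%g (colour x))]) = (2^-1)%:E * lam B.
Proof.
have -> : lam B = mu ([set x | B (gap_at 1%g (colour x))] `&` admissible_set) * (2^-1)^-1%:E.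
  exact: (conditionedE measurable_admissible_set mu_admissible_set inv2_gt0).
by rewrite setIC muleC -muleA -EFinM mulVf ?mule1 // invr_neq0.
Qed.

Lemma measurable_gap_event w (B : set nat) : measurable [set x | B (gap_at w (colour x))].
Proof. exact: (@countably_measurableP _ _ _ _ B (measurable_gap_at w measurable_colour)). Qed.

Lemma measurable_forall_in (J : eqType) (s : seq J) (F : J -> set X) :
  (forall v, measurable (F v)) -> measurable [set x | forall v, v \in s -> F v x].
Proof.
move=> mF; elim: s => [|v s IH].
  by rewrite (_ : mkset _ = setT) //; apply/seteqP; split.
rewrite (_ : mkset _ = F v `&` [set x | forall v, v \in s -> F v x]); first exact: measurableI.
apply/seteqP; split=> x /=.
  by move=> H; split=> [|u us]; apply: H; rewrite inE ?eqxx ?us ?orbT.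
by move=> [Fv H] u; rewrite inE => /predU1P[->//|]; exact: H.
Qed.

(** Fix the first gap l. It is read off the a-line up to the zero at l + 1, and the later gaps off
    the line from there on. Only the bit of that zero is shared, and its factor 2 cancels one of the
    two measures 1/2. *)
Lemma forward_gap_law (n : nat) (A : nat -> set nat) :
  mu (admissible_set `&` [set x | forall k, k \in iota 0 n -> A k (gap_at (cpow k%:Z) (colour x))])
  = (2^-1)%:E * \prod_(k <- iota 0 n) lam (A k).
Proof.
elim: n A => [|n IH] A.
  rewrite big_nil mule1 -mu_admissible_set; congr (mu _).
  by apply/seteqP; split=> // x [].
pose Q := admissible_set `&` [set x | forall k, k \in iota 0 n -> A k.+1 (gap_at (cpow k%:Z) (colour x))].
have mQ : measurable Q.
  apply: measurableI; first exact: measurable_admissible_set.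
  by apply: measurable_forall_in => k; exact: measurable_gap_event.
have muQ : mu Q = (2^-1)%:E * \prod_(k <- iota 0 n) lam (A k.+1) := IH (fun k => A k.+1).
set V := _ `&` _; pose E0 := admissible_set `&` [set x | A 0%N (gap_at 1%g (colour x))].
have mE0 : measurable E0.
  by apply: measurableI; [exact: measurable_admissible_set|exact: measurable_gap_event].
have mV : measurable V.
  apply: measurableI; first exact: measurable_admissible_set.
  by apply: measurable_forall_in => k; exact: measurable_gap_event.
have VE0 : mu V = (2 * fine (mu Q))%:E * mu E0.
  apply: (@measure_partition_eq _ _ _ _ _ _ mu mu V E0 (fun x => gap_at 1%g (colour x))
    (fun x => gap_at 1%g (colour x))) => //.
  - by rewrite mulr_ge0 // fine_ge0.
  - exact: (measurable_gap_at 1%g measurable_colour).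
  - exact: (measurable_gap_at 1%g measurable_colour).
  move=> l; set D := [set x | _ = l]; pose g := apow l.+1%:Z.
  have mD : measurable D by exact: (measurable_gap_event 1%g [set m | m = l]).
  have gD x : admissible_set x -> D x -> colour x g = true /\
      forall k : nat, (0 < k)%N -> (k <= l)%N -> ~~ colour x (apow k%:Z).
    move=> ax; rewrite /D /= gap_at1 => dl.
    by have [eg _ _ _] := admissible_line ax; have [] := gapP eg; rewrite dl.
  have -> : V `&` D = (E0 `&` D) `&` (T g @^-1` Q).
    have step0 x : admissible_set x -> D x -> cocycle (fg_letter (ord0, false)) (colour x) = g.
      by move=> ax; rewrite /D /= gap_at1 cocycle_letter /step /= => ->.
    have tail k x : admissible_set x -> D x ->
        gap_at (cpow k.+1%:Z) (colour x) = gap_at (cpow k%:Z) (colour (T g x)).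
      move=> ax dx; rewrite (colour_shift mu_product) intS addrC cpowD (cpow_letter false).
      by rewrite gap_atM // step0.
    apply/seteqP; split=> x.
      move=> [[ax Vx] dx]; split; first by split=> //; split=> //; exact: (Vx 0%N).
      split; last by move=> k kn; rewrite -tail //; apply: Vx; rewrite !mem_iota in kn *; lia.
      rewrite /admissible_set /= (colour_shift mu_product).
      by rewrite -(step0 x) //; exact: cocycle_admissible.
    move=> [[[ax A0] dx] [_ Qx]]; split=> //; split=> // -[_|k kn]; first exact: A0.
    by rewrite tail //; apply: Qx; rewrite !mem_iota in kn *; lia.
  (* Vertices beyond the zero g, up to powers of b. *)
  pose P : set F2 := [set h | exists j i, (l.+1%:Z < i)%R /\ h = (zexpg (blet false) j * apow i)%g].
  have nP i : (i <= l.+1%:Z)%R -> ~ P (apow i).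
    move=> il [j [i' [li]]]; rewrite -{1}[apow i]mul1g -(zexpg0 (blet false)) => /b_apow_inj ii'.
    by move: il; rewrite ii' leNgt li.
  have muTQ : mu (T g @^-1` Q) = (fine (mu Q))%:E.
    by rewrite fineK ?fin_num_measure //; exact: mu_preimage.
  suff indep : mu ((E0 `&` D) `&` (T g @^-1` Q)) = 2%:E * (mu (E0 `&` D) * mu (T g @^-1` Q)).
    by rewrite [LHS]indep muTQ EFinM muleCA muleC.
  apply: (@colour_independent_given _ _ mu_product P g true) => //.
  - exact: mu_good_set.
  - move=> h j [j' [i [li ->]]]; exists (j + j')%R, i; split=> //.
    by rewrite zexpgD mulgA.
  - exact: nP.
  - exact: measurableI.
  - exact: measurable_preimage.
  - by move=> x [[ax _] dx]; have [] := gD x ax dx.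
  - by move=> x [[_ _]]; rewrite (colour_shift mu_product) /recenter mul1g.
  - move=> x x' gx gx' xx' [[ax A0] dx]; have [zg ng] := gD x ax dx.
    have eqc i : (i <= l.+1%:Z)%R -> colour x (apow i) = colour x' (apow i).
      by move=> il; apply: xx'; exact: nP.
    have ax' : admissible_set x'.
      split=> //; first exact: colour_b_invariant.
      by rewrite -[1%g]/(apow 0) -eqc //; case: ax.
    have dx' : D x'.
      rewrite /D /= gap_at1; apply: search_eq; first by rewrite /aline -eqc.
      by move=> k kl; rewrite /aline -eqc; [apply: ng|]; lia.
    by split=> //; split=> //; move: A0; rewrite /= dx dx'.
  move=> x x' gx gx' xx' xg [[_ gTx cTx] Qx].
  have leq' (i : nat) : aline (colour (T g x)) i%:Z = aline (colour (T g x')) i%:Z.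
    rewrite !(colour_shift mu_product) /aline /recenter -apowD.
    case: i => [|i]; first by rewrite add0r.
    by apply: xx'; exists 0%R, (i.+1%:Z + l.+1%:Z)%R; rewrite zexpg0 mul1g; split=> //; lia.
  split.
    split; first exact: colour_b_invariant.
      by rewrite (colour_shift mu_product) => h; rewrite recenterM; exact: gx'.
    by move: cTx; rewrite -!aline0 -(leq' 0%N).
  by move=> k kn; have := Qx k kn; rewrite /= (gap_at_nat k leq').
have iotaE : iota 0 n.+1 = 0%N :: map S (iota 0 n).
  by rewrite -(eq_map add1n) -iotaDl addn0.
rewrite VE0 mu_gap muQ iotaE big_cons big_map.
rewrite EFinM fineK; last by rewrite -muQ fin_num_measure.
rewrite !muleA -EFinM divff // mul1e muleC muleA.
by rewrite [LHS]muleC muleA.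
Qed.

Lemma cocycle_preserving w (B : set X) : measurable B ->
  mu (admissible_set `&` [set x | B (T (cocycle w (colour x)) x)]) = mu (admissible_set `&` B).
Proof.
move=> mB; have inv v x : admissible_set x ->
    (cocycle v^-1%g (colour (T (cocycle v (colour x)) x)))^-1%g = cocycle v (colour x).
  move=> ax; apply: (mulgI (cocycle v^-1%g (colour (T (cocycle v (colour x)) x)))).
  by rewrite mulgV (colour_shift mu_product) -cocycleM // mulVg.
have adm v x : admissible_set x -> admissible_set (T (cocycle v (colour x)) x).
  by move=> ax; rewrite /admissible_set /= (colour_shift mu_product); exact: cocycle_admissible.
have mc v : countably_measurable (fun x => cocycle v (colour x)).
  exact: (measurable_word_cocycle (val v) measurable_colour).
apply: (piecewise_preserving (u := fun z => (cocycle w^-1%g (colour z))^-1%g)) => //.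
- exact: (@countably_measurable_comp _ _ _ _ _ (fun g : F2 => g^-1%g) (mc w^-1%g)).
- exact: measurable_admissible_set.
- exact: measurable_admissible_set.
- by move=> x ax; split; [exact: adm|exact: inv].
- move=> z az; rewrite invgK; split; first exact: adm.
  by have /(congr1 (fun g : F2 => g^-1%g)) := inv w^-1%g z az; rewrite !invgK.
Qed.

Lemma line_law (Ks : seq int) (A : int -> set nat) : uniq Ks ->
  mu (admissible_set `&` [set x | forall k, k \in Ks -> A k (gap_at (cpow k) (colour x))])
  = (2^-1)%:E * \prod_(k <- Ks) lam (A k).
Proof.
(* Starting at c1^-m makes all exponents in [Ks] lie between 0 and 2 m; [B] fills the other
   positions with the full space. *)
move=> uKs; pose m := (\sum_(k <- Ks) `|k|)%N.
have mK k : k \in Ks -> (`|k| <= m)%N.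
  by move=> kK; rewrite /m (big_rem k) //= leq_addr.
pose B (i : nat) := if (i%:Z - m%:Z)%R \in Ks then A (i%:Z - m%:Z)%R else setT.
have := forward_gap_law (m + m).+1 B; set n := (m + m).+1.
set Q := [set x | forall k, k \in iota 0 n -> _] => QE.
have mQ : measurable Q by apply: measurable_forall_in => k; exact: measurable_gap_event.
have -> : \prod_(k <- Ks) lam (A k) = \prod_(k <- iota 0 n) lam (B k).
  have pe : perm_eq Ks [seq (i%:Z - m%:Z)%R | i : nat <- [seq i : nat <- iota 0 n | (i%:Z - m%:Z)%R \in Ks]].
    apply: uniq_perm => //.
      by rewrite map_inj_uniq ?filter_uniq ?iota_uniq // => i j /addIr [].
    move=> k; apply/idP/mapP => [kK|[i]]; last by rewrite mem_filter => /andP[iK _] ->.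
    have kE : (`|(k + m%:Z)%R|%N%:Z - m%:Z)%R = k by have := mK k kK; lia.
    exists `|(k + m%:Z)%R|%N; last by rewrite kE.
    by rewrite mem_filter [X in X && _]/= kE kK mem_iota /n; have := mK k kK; lia.
  rewrite (perm_big _ pe) big_map big_filter /= [RHS](bigID (fun i : nat => (i%:Z - m%:Z)%R \in Ks)) /=.
  rewrite [X in _ * X]big1 ?mule1; last by move=> i /negbTE iK; rewrite /B iK probability_setT.
  by apply: eq_bigr => i iK; rewrite /B iK.
rewrite -QE -(cocycle_preserving (cpow (- m%:Z)%R) mQ); congr (mu _).
apply/seteqP; split=> x [ax Hx]; split=> // k kK.
  rewrite (colour_shift mu_product) -gap_atM // -cpowD /B.
  by case: ifP => // iK; exact: Hx.
have kn : `|(k + m%:Z)%R|%N \in iota 0 n by rewrite mem_iota /n; have := mK k kK; lia.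
have := Hx _ kn; rewrite /= (colour_shift mu_product) -gap_atM // -cpowD /B.
have -> : (`|(k + m%:Z)%R|%N%:Z - m%:Z)%R = k by have := mK k kK; lia.
by rewrite kK.
Qed.

End LineLaw.

Lemma cpow_decomposition w : exists k, w = (cpow k * fg_eval (strip ord0 (val w)))%g.
Proof.
have rw := valP w; rewrite -{1}(fg_eval_val w); elim: (val w) rw => [_|l s IH rs].
  by exists 0; rewrite mul1g.
have [k E] := IH (reduced_behead rs); rewrite [strip _ _]/=.
have [l0|l0] := eqVneq l.1 ord0; last by exists 0; rewrite mul1g.
exists ((if l.2 then -1 else 1) + k); rewrite cpowD -mulgA -E cpow_letter -l0.
by rewrite -surjective_pairing.
Qed.

(* The position, relative to its entry vertex, of the zero at which the line of
   a word is entered. *)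
Definition entry_offset (third : bool) (c : coloring) : int :=
  if third then - (match_dist (dual (aline c)))%:Z else 0.

(** * Independence of the gaps on several lines *)

Section JointLaw.
Context (R : realType) (mu : probability coset_space R).
Hypothesis mu_product : is_product_measure (uniform_Z2 R) mu.
Local Open Scope ereal_scope.

Local Notation T := (coset_shift mu_product).
Local Notation X := coset_space.
Local Notation lam := (first_gap_law mu).

(** An event about a line viewed from its entry: if b holds, the entry is a one and B is tested at
    the matched zero. *)
Definition entered_line (b : bool) (B : set coloring) : set X :=
  [set x | [/\ good (colour x), colour x 1%g = ~~ b &
              B (recenter (apow (entry_offset b (colour x))) (colour x))]].

(** For b true, going from a one to its matched zero is a piecewise translation with inverse given
    by the matching, so [piecewise_preserving] applies. *)
Lemma entered_line_law b (B : set coloring) :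
  measurable [set x | B (colour x)] -> measurable (entered_line b B) /\
  mu (entered_line b B) = mu (admissible_set `&` [set x | B (colour x)]).
Proof.
move=> mB; case: b; last first.
  have -> : entered_line false B = admissible_set `&` [set x | B (colour x)].
    apply/seteqP; split=> x.
      by move=> [gx cx Bx]; split; [split=> //; exact: colour_b_invariant|move: Bx; rewrite recenter1].
    by move=> [[_ gx cx] Bx]; split=> //; rewrite recenter1.
  by split=> //; apply: measurableI => //; exact: measurable_admissible_set.
pose P : set X := good_set `&` [set x | colour x 1%g = false].
have mP : measurable P.
  by apply: measurableI; [exact: measurable_good_set|exact: measurable_colour].
pose s (x : X) := apow (entry_offset true (colour x)).
pose u (x : X) := apow (- (match_dist (aline (colour x)))%:Z)%R.
have mL : measurable_line (fun x : X => aline (colour x)) by move=> i; exact: measurable_colour.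
have ms : countably_measurable s.
  apply: (@countably_measurable_comp _ _ _ _ _ (fun m : nat => apow (- m%:Z)%R)).
  exact/measurable_line_match/measurable_line_dual.
have mu' : countably_measurable u.
  apply: (@countably_measurable_comp _ _ _ _ _ (fun m : nat => apow (- m%:Z)%R)).
  exact: measurable_line_match.
have E : entered_line true B = P `&` [set x | B (colour (T (s x) x))].
  apply/seteqP; split=> x.
    by move=> [gx cx Bx]; split=> //=; rewrite (colour_shift mu_product).
  by move=> [[gx cx] /=]; rewrite (colour_shift mu_product) => Bx; split.
have good_shift g x : good (colour x) -> good (colour (T g x)).
  by move=> gx h; rewrite (colour_shift mu_product) recenterM; exact: gx.
split.
  rewrite E; apply: measurableI => //.
  rewrite (_ : mkset _ = [set x | exists g, s x = g /\ B (colour (T g x))]).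
    apply: exists_measurable => g; apply: measurableI; first exact: ms.
    exact: (measurable_preimage mu_product g mB).
  by apply/seteqP; split=> x /= => [Bx|[g [<-]]//]; exists (s x).
rewrite E; apply: (@piecewise_preserving _ _ mu_product s u P admissible_set
  [set x | B (colour x)]) => //.
- exact: measurable_admissible_set.
- move=> x [gx cx]; have [_ _ _ em] : line_good (aline (colour x)).
    by have := gx 1%g; rewrite recenter1.
  have c0 : ~~ aline (colour x) 0 by rewrite aline0 cx.
  have [zx mx] := match_dual_back c0 (em c0).
  split.
    split; [exact: colour_b_invariant|exact: good_shift|].
    by rewrite (colour_shift mu_product) /recenter mul1g.
  by rewrite /u (colour_shift mu_product) aline_recenter mx.
move=> z [_ gz cz]; have [_ _ em _] : line_good (aline (colour z)).
  by have := gz 1%g; rewrite recenter1.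
have [_ nz _] := match_distP cz (em cz).
have uz : ((u z)^-1 = apow (match_dist (aline (colour z)))%:Z)%g.
  by rewrite /u /apow zexpgN invgK.
rewrite uz; split.
  split; first exact: good_shift.
  by rewrite /= (colour_shift mu_product) /recenter mul1g; exact: negbTE.
rewrite /s /entry_offset (colour_shift mu_product) aline_recenter match_dual //.
exact: em.
Qed.

Lemma joint_gap_law (J : seq F3) (A : F3 -> set nat) : uniq J ->
  mu (admissible_set `&` [set x | forall v, v \in J -> A v (gap_at v (colour x))])
  = (2^-1)%:E * \prod_(v <- J) lam (A v).
Proof.
have [n] := ubnP (size J); elim: n J => // n IH J Jn uJ.
have [J0|[w wJ wmax]] : J = [::] \/ exists2 w, w \in J &
    forall v, v \in J -> (weight ord0 (val v) <= weight ord0 (val w))%N.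
  clear; elim: J => [|v J [->|[w wJ wmax]]]; [by left|right|right].
    by exists v; rewrite ?inE // => u; rewrite inE => /eqP->.
  have [le|lt] := leqP (weight ord0 (val v)) (weight ord0 (val w)).
    exists w; first by rewrite inE wJ orbT.
    by move=> u; rewrite inE => /predU1P[->//|]; exact: wmax.
  exists v; first by rewrite inE eqxx.
  move=> u; rewrite inE => /predU1P[->//|uJ].
  exact: leq_trans (wmax u uJ) (ltnW lt).
  rewrite J0 big_nil mule1 -(mu_admissible_set mu_product); congr (mu _).
  by apply/seteqP; split=> // x [].
pose u0 := strip ord0 (val w); pose w0 := fg_eval u0.
have vw0 : val w0 = u0 by rewrite fg_eval_reduced // strip_reduced // (valP w).
pose same := fun v : F3 => strip ord0 (val v) == u0.
pose J1 := [seq v <- J | same v]; pose J2 := [seq v <- J | ~~ same v].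
have prodJ : \prod_(v <- J) lam (A v) = (\prod_(v <- J1) lam (A v)) * \prod_(v <- J2) lam (A v).
  by rewrite /J1 /J2 !big_filter [LHS](bigID same).
have IH2 := IH J2 _ (filter_uniq _ uJ).
have J2n : (size J2 < n)%N.
  rewrite -ltnS; apply: leq_trans _ Jn; rewrite ltnS size_filter.
  rewrite -(count_predC same J) -[X in (X < _)%N]add0n ltn_add2r -has_count.
  by apply/hasP; exists w => //; rewrite /same eqxx.
move: IH2 => /(_ J2n) IH2.
set V := _ `&` _; set F2s := _ `&` _ in IH2.
have mF (K : seq F3) : measurable (admissible_set `&`
    [set x | forall v, v \in K -> A v (gap_at v (colour x))]).
  apply: measurableI; first exact: measurable_admissible_set.
  by apply: measurable_forall_in => v; exact: measurable_gap_event.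
have [kz Hkz] := choice cpow_decomposition.
pose b := third u0.
pose B : set coloring := [set c | forall k, k \in map kz J1 -> A (cpow k * w0)%g (gap_at (cpow k) c)].
have mB : measurable [set x : X | B (colour x)].
  by apply: measurable_forall_in => k; exact: (measurable_gap_event (cpow k) (A (cpow k * w0)%g)).
have J1E v : v \in J1 -> v = (cpow (kz v) * w0)%g.
  by rewrite mem_filter => /andP[/eqP sv _]; rewrite {1}(Hkz v) sv.
have [mQ muQ] := entered_line_law b mB.
have {}muQ : mu (entered_line b B) = (2^-1)%:E * \prod_(v <- J1) lam (A v).
  rewrite muQ (line_law mu_product (fun k => A (cpow k * w0)%g)).
    congr (_ * _); rewrite big_map big_seq [RHS]big_seq.
    by apply: eq_bigr => v vJ; rewrite -J1E.
  rewrite map_inj_in_uniq ?filter_uniq // => v v' vJ vJ' e.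
  by rewrite (J1E v vJ) (J1E v' vJ') e.
pose p1 := fine (\prod_(v <- J1) lam (A v)).
have p1E : \prod_(v <- J1) lam (A v) = p1%:E.
  by rewrite fineK // prode_fin_num // => v _; exact: fin_num_measure.
have p1_ge0 : (0 <= p1)%R.
  by apply: fine_ge0; apply: prode_ge0.
suff -> : mu V = p1%:E * mu F2s.
  by rewrite IH2 prodJ p1E muleCA.
(* The line of w is a random a-line; its entry is the variable to condition on. *)
pose f (x : X) := entry (val w) (colour x).
have mf : countably_measurable f by exact: (measurable_entry (val w) measurable_colour).
apply: (@measure_partition_eq _ _ _ _ _ _ mu mu V F2s f f) => //; try exact: mF.
move=> g; set D := [set x | f x = g].
have mD : measurable D by exact: mf.
(* A point with entry g shows that g has the stripped form and the depth of w; without one, both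
   sides are measures of the empty set. *)
have [[x0 [Fx0 fx0]]|empty] := pselect (exists x, F2s x /\ f x = g); last first.
  have E1 : F2s `&` D = set0.
    by apply/seteqP; split=> // x [Fx fx]; apply: empty; exists x.
  have E2 : V `&` D = set0.
    apply/seteqP; split=> // x [[ax Vx] fx]; apply: empty; exists x; split=> //; split=> // v.
    by rewrite mem_filter => /andP[_ vJ]; exact: Vx.
  by rewrite E1 E2 !measure0 mule0.
have ax0 : admissible (colour x0) by case: Fx0.
have sg : strip ord0 (val g) = val g by rewrite -fx0 strip_entry // (valP w).
have wg : weight ord0 (val g) = weight ord0 (val w).
  by rewrite -fx0; have [] := normal_form ax0 (valP w).
have bE : b = third (val w) by rewrite /b /third /u0 strip_id.
have fz x : admissible (colour x) -> f x = g -> colour x g = ~~ b.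
  by move=> ax <-; rewrite entry_zero // bE.
have line_at v x : admissible (colour x) -> f x = g -> v \in J1 ->
    gap_at v (colour x) = gap_at (cpow (kz v))
      (recenter (apow (entry_offset b (colour (T g x)))) (colour (T g x))).
  move=> ax fx vJ; rewrite {1}(J1E v vJ) gap_atM //; congr gap_at.
  have -> : cocycle w0 (colour x) = (apow (base_offset (val w) (colour x)) * g)%g.
    by rewrite /cocycle vw0 /u0 word_cocycle_strip // -/(f x) fx.
  rewrite (colour_shift mu_product) recenterM.
  by rewrite /base_offset /entry_offset bE -/(f x) fx.
(* On D the labels of [J1] lie on the a-line of g, so together they form an event seen from g x. *)
have VD : V `&` D = (F2s `&` D) `&` (T g @^-1` entered_line b B).
  apply/seteqP; split=> x.
    move=> [[ax Vx] fx]; split.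
      by split=> //; split=> // v; rewrite mem_filter => /andP[_ vJ]; exact: Vx.
    split.
    - by move=> h; rewrite (colour_shift mu_product) recenterM; case: ax.
    - by rewrite (colour_shift mu_product) /recenter mul1g; exact: fz.
    move=> k /mapP[v vJ ->]; rewrite -J1E // -line_at //; apply: Vx.
    by move: vJ; rewrite mem_filter => /andP[].
  move=> [[[ax F2x] fx] [_ _ Bx]]; split=> //; split=> // v vJ.
  have [sv|sv] := boolP (same v); last by apply: F2x; rewrite mem_filter sv.
  have vJ1 : v \in J1 by rewrite mem_filter sv.
  by rewrite /= line_at //; have := Bx (kz v) (map_f _ vJ1); rewrite -J1E.
have nb h : strip ord0 (val h) = val h -> (weight ord0 (val h) <= weight ord0 (val g))%N ->
    ~ branch g h.
  by move=> sh le; rewrite -[h]mul1g; apply: (@branch_line g h 0%R) => //; right.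
(* The entry and the labels of [J2] read no colour in the branch of g; the line of g reads only the
   branch and the bit at g. *)
have indep : mu ((F2s `&` D) `&` (T g @^-1` entered_line b B)) =
    2%:E * (mu (F2s `&` D) * mu (T g @^-1` entered_line b B)).
  apply: (@colour_independent_given _ _ mu_product (branch g) g (~~ b)) => //.
  - exact: mu_good_set.
  - by move=> h j; exact: branch_b.
  - exact: nb.
  - by apply: measurableI => //; exact: mF.
  - exact: (measurable_preimage mu_product).
  - by move=> x [[ax _] fx]; exact: fz.
  - by move=> x [_ + _]; rewrite (colour_shift mu_product) /recenter mul1g.
  - move=> x x' gx gx' xx' [[ax F2x] fx].
    have ax' : admissible (colour x').
      split=> //; first exact: colour_b_invariant.
      by rewrite -xx'; [case: ax|apply: nb].
    have off : agree_off g (colour x) (colour x') by [].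
    have [eE _] := cocycle_agree sg ax ax' off (valP w) ltac:(by rewrite wg).
    split; last by rewrite /D /= /f eE.
    split=> // v vJ; have := F2x v vJ; rewrite /=.
    move: vJ; rewrite mem_filter => /andP[sv vJ].
    have [|_ H] := cocycle_agree sg ax ax' off (valP v); first by rewrite wg; exact: wmax.
    have [|cE lE] := H.
      (* A word entering at g would lie on the line of w, hence outside [J2]. *)
      rewrite -fx => /(entry_inj ax) sE.
      by move: sv; rewrite /same sE eqxx.
    by rewrite /gap_at /cocycle cE lE.
  move=> x x' gx gx' xx' xg [_ cTx Bx].
  have leq' : aline (colour (T g x)) = aline (colour (T g x')).
    apply/funext => i; rewrite !(colour_shift mu_product) /aline /recenter.
    have [->|i0] := eqVneq i 0%R; first by rewrite mul1g.
    by apply: xx'; exists 0%R, i; rewrite zexpg0 mul1g.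
  split.
  - by move=> h; rewrite (colour_shift mu_product) recenterM; exact: gx'.
  - by rewrite -aline0 -leq'.
  move=> k kJ; have := Bx k kJ; rewrite /entry_offset leq' => H.
  by rewrite -(@gap_at_line k (recenter (apow (entry_offset b (colour (T g x')))) (colour (T g x)))) //
    !aline_recenter leq'.
have muT : mu (T g @^-1` entered_line b B) = (2^-1)%:E * p1%:E.
  by rewrite (mu_preimage mu_product g mQ) muQ p1E.
rewrite VD [LHS]indep muT muleCA [2%:E * _]muleA.
by rewrite -[2%:E * _]EFinM divff // mul1e muleC.
Qed.

End JointLaw.

(** * The isomorphism *)

(** A Cauchy filter for the discrete uniformity contains a singleton. Completeness is required by
    [standard_borel]. *)
Lemma nat_complete (F : set_system nat) : ProperFilter F -> cauchy F -> cvg F.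
Proof.
move=> FF cF; have [|[A B] /= [FA FB] AB] := cF [set p | p.1 = p.2].
  by rewrite uniform_discrete => _ [n _ <-].
have [n [An Bn]] : (A `&` B) !=set0 by exact: (filter_ex (filterI (FA : F A) (FB : F B))).
apply/cvg_ex; exists n => U /nbhs_singleton Un; apply: filterS FB => m Bm.
by have /= <- := AB (n, m) (conj An Bm).
Qed.

HB.instance Definition _ := Uniform_isComplete.Build nat nat_complete.

Lemma standard_borel_nat (R : realType) : standard_borel R nat.
Proof.
exists nat, id; split.
- exact: discrete_hausdorff.
- exists setT; first exact: countableP.
  by move=> U [x Ux] _; exists x.
- by exists id.
- move=> A; rewrite image_id; split=> // _.
  by apply: sub_sigma_algebra => /=; exact: discrete_open.
Qed.

Section Isomorphism.
Context (R : realType) (mu : probability coset_space R).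
Hypothesis mu_product : is_product_measure (uniform_Z2 R) mu.
Local Open Scope ereal_scope.

Local Notation T := (coset_shift mu_product).
Local Notation X := coset_space.
Local Notation Y := (product_space F3 nat).
Local Notation lam := (first_gap_law mu).

(** The gap is 0 exactly when the next vertex is a zero too, with probability 1/2, so no atom has
    mass 1. *)
Lemma first_gap_law_nontrivial : nontrivial_base lam.
Proof.
pose E0 : set X := [set x | colour x 1%g = true].
pose E1 : set X := T (apow 1) @^-1` E0.
have m0 : measurable E0 by exact: measurable_colour.
have m1 : measurable E1 by exact: measurable_preimage.
have mE : mu (E0 `&` E1) = (2^-1)%:E * (2^-1)%:E.
  rewrite (@colour_independent _ _ mu_product (branch 1%g) E0 E1) //.
  - by rewrite (mu_bit mu_product) (mu_preimage mu_product _ m0) (mu_bit mu_product).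
  - by move=> h j; exact: branch_b.
  - exact: branch_irrefl1.
  - by move=> x x' xx'; rewrite /E0 /= xx' //; exact: branch_irrefl1.
  - move=> x x' xx'; rewrite /E1 /E0 /= !(colour_shift mu_product) /recenter mul1g xx' //.
    by exists 0%R, 1%R; rewrite zexpg0 mul1g mulg1.
have lam0 : lam [set 0%N] = (2^-1)%:E.
  have -> : lam [set 0%N] = 2%:E * ((2^-1)%:E * lam [set 0%N]).
    by rewrite muleA -EFinM divff // mul1e.
  rewrite -(mu_gap mu_product) (_ : mu _ = mu (E0 `&` E1)).
    by rewrite mE -!EFinM mulrA divff // mul1r.
  apply: (measure_eq_on _ _ measurable_good_set (mu_good_set mu_product)).
  - apply: measurableI; first exact: measurable_admissible_set.
    exact: (measurable_gap_event 1%g [set 0%N]).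
  - exact: measurableI.
  apply/seteqP; split=> x.
    move=> [[ax g0] gx]; split=> //; split; first by case: ax.
    rewrite /E1 /E0 /= (colour_shift mu_product) /recenter mul1g.
    have [eg _ _ _] := admissible_line ax; have [+ _] := gapP eg.
    by move: g0; rewrite /= gap_at1 => ->.
  move=> [[c0 c1] gx]; split=> //; split; first by split=> //; exact: colour_b_invariant.
  rewrite /= gap_at1; apply: search_eq => //.
  by move: c1; rewrite /E1 /E0 /= (colour_shift mu_product) /recenter mul1g.
move=> [[|l] lamE].
  move: lamE; rewrite lam0 => -[] h; have : (2 * 2^-1 = 2 * 1 :> R)%R by rewrite h.
  by rewrite divff // mulr1 => /esym /eqP; rewrite (eqr_nat R 2 1).
have add : lam ([set 0%N] `|` [set l.+1]) = lam [set 0%N] + lam [set l.+1].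
  by apply: measureU => //; apply/seteqP; split=> // n [/= ->].
have : lam ([set 0%N] `|` [set l.+1]) <= 1 by exact: probability_le1.
rewrite add lam0 lamE -EFinD lee_fin -[leRHS]add0r lerD2r leNgt invr_gt0.
by rewrite ltr0n.
Qed.

Definition code (x : X) : Y := gap_code (colour x).

Lemma measurable_code : measurable_fun setT code.
Proof.
apply: measurable_fun_product => w A mA.
exact: (@countably_measurableP _ _ _ _ A (measurable_gap_code w measurable_colour)).
Qed.

Definition code_mfun : {mfun X >-> Y} :=
  HB.pack code (isMeasurableFun.Build _ _ _ _ _ measurable_code).

Definition code_law : probability Y R :=
  distribution (conditioned mu measurable_admissible_set) code_mfun.

Lemma code_lawE B : code_law B = mu (code @^-1` B `&` admissible_set) * (2^-1)^-1%:E.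
Proof.
exact: (conditionedE measurable_admissible_set (mu_admissible_set mu_product) (inv2_gt0 R)).
Qed.

Lemma code_law_product : is_product_measure lam code_law.
Proof.
move=> J A mA; rewrite [LHS]code_lawE.
have -> : code @^-1` cylinder J A `&` admissible_set = admissible_set `&`
    [set x | forall v, v \in [seq w^-1%g | w : F3 <- J] -> A v^-1%g (gap_at v (colour x))].
  apply/seteqP; split=> x.
    by move=> [Jx ax]; split=> // _ /mapP[w wJ ->]; rewrite invgK; exact: Jx.
  move=> [ax Jx]; split=> // w wJ; have := Jx w^-1%g (map_f _ wJ).
  by rewrite /= invgK.
rewrite (joint_gap_law mu_product (fun v => A v^-1%g)); last first.
  by rewrite map_inj_uniq ?fset_uniq // => v w /invg_inj.
rewrite big_map muleC muleA -EFinM mulVf ?mul1e ?invr_neq0 //.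
by apply: eq_bigr => w _; rewrite invgK.
Qed.

(* The zeros of x are exactly the vertices reached by its cocycle. *)
Definition decode (y : Y) : X := fun C =>
  if `[< exists w : F3, C = coset_of_b (cocycle_of_code y (val w))^-1%g >] then 0%R else 1%R.

Lemma decodeK x : admissible (colour x) -> decode (code x) = x.
Proof.
move=> ax; apply/colour_inj/funext => h; rewrite /colour /decode.
have -> : `[< exists w : F3, coset_of_b h^-1%g =
    coset_of_b (cocycle_of_code (code x) (val w))^-1%g >] = colour x h.
  apply/asboolP/idP => [[w]|ch].
    rewrite cocycle_of_codeE ?(valP w) // => e.
    by rewrite /colour e; exact: (word_cocycle_zero (val w) ax).
  have [w wh] := cocycle_onto ax ch.
  by exists w; rewrite cocycle_of_codeE ?(valP w) // -/(cocycle w _) wh.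
by rewrite /colour; case: (x _ == 0%R).
Qed.

Lemma measurable_decode : measurable_coloring (fun y => colour (decode y)).
Proof.
move=> h; apply: countably_measurable_bool.
rewrite (_ : mkset _ = [set y : Y | exists w : F3,
    coset_of_b h^-1%g = coset_of_b (cocycle_of_code y (val w))^-1%g]).
  apply: exists_measurable => w.
  have mc : countably_measurable (fun y : Y => cocycle_of_code y (val w)).
    apply: (@measurable_cocycle_of_code _ _ (fun y : Y => y)) => v n.
    exact: (measurable_coordinate v (I : measurable [set n])).
  exact: (@countably_measurableP _ _ _ _ [set g | coset_of_b h^-1%g = coset_of_b g^-1%g] mc).
by apply/seteqP; split=> y /=; rewrite /colour /decode; case: asboolP.
Qed.

Lemma measurable_fun_decode : measurable_fun setT decode.
Proof.
apply: measurable_fun_product => C A _; have [g ->] := coset_of_b_onto C.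
have -> : [set y | A (decode y (coset_of_b g))] =
    [set y | (fun b : bool => A (if b then 0%R else 1%R)) (colour (decode y) g^-1%g)].
  by apply/seteqP; split=> y /=; rewrite /colour /decode invgK; case: asboolP.
exact: (@countably_measurableP _ _ _ _ (fun b : bool => A (if b then 0%R else 1%R))
  (measurable_decode g^-1%g)).
Qed.

(* The image of the admissible set, described so as to be visibly measurable. *)
Definition code_range : set Y :=
  [set y | admissible_set (decode y) /\ code (decode y) = y].

Lemma measurable_code_range : measurable code_range.
Proof.
apply: measurableI.
  rewrite -[X in measurable X]setTI; apply: measurable_fun_decode => //.
  exact: measurable_admissible_set.
rewrite (_ : (fun _ => _) = [set y : Y | forall w, (code (decode y) w == y w) = true]).
  apply: forall_measurable => w.
  apply: (@countably_measurable_comp2 _ _ _ _ _ _ _ (fun m n : nat => m == n)).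
    exact: (measurable_gap_code w measurable_decode).
  by move=> n; exact: (measurable_coordinate w (I : measurable [set n])).
apply/seteqP; split=> y /= => [-> w|H]; first by rewrite eqxx.
by apply/funext => w; exact/eqP/H.
Qed.

Lemma code_in_range x : admissible_set x -> code_range (code x).
Proof. by move=> ax; rewrite /code_range /= decodeK. Qed.

(** The zeros of the orbit are the vertices [cocycle w] by [cocycle_onto], and [gap_code_move] turns
    a move by [cocycle w] into the shift by w. *)
Lemma code_orbit x : admissible_set x ->
  code @` (act_orbit T x `&` admissible_set) =
  act_orbit (bernoulli_shift code_law_product) (code x) `&` code_range.
Proof.
move=> ax.
have code_move w : code (T (cocycle w (colour x)) x) =
    bernoulli_shift code_law_product w (code x).
  by rewrite /code (colour_shift mu_product) gap_code_move.
apply/seteqP; split=> y.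
  move=> [_ [[g _ <-] ag] <-]; split; last exact: code_in_range.
  have cg : colour x g.
    by case: ag; rewrite (colour_shift mu_product) /recenter mul1g.
  by have [w <-] := cocycle_onto ax cg; exists w.
move=> [[w _ <-] _]; exists (T (cocycle w (colour x)) x) => //; split.
  by exists (cocycle w (colour x)).
by rewrite /admissible_set /= (colour_shift mu_product); exact: cocycle_admissible.
Qed.

Lemma coset_shift_soe :
  stably_orbit_equivalent T (bernoulli_shift code_law_product).
Proof.
have mS := measurable_admissible_set; have muS := mu_admissible_set mu_product.
(* The Bernoulli side uses its whole space, since [code_law] is already the image of the measure
   conditioned on the zeros. *)
exists admissible_set, setT, code; split.
- by split=> //; rewrite muS lte_fin inv2_gt0.
- by split=> //; rewrite probability_setT.
- by [].
exists admissible_set, code_range; split.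
- by split=> //; rewrite setDv measure0.
- split=> //; first exact: measurable_code_range.
  rewrite [LHS]code_lawE (_ : _ `&` _ = set0) ?measure0 ?mul0e //.
  by apply/seteqP; split=> // x [[_ nr] ax]; apply: nr; exact: code_in_range.
- split.
  + split=> [x ax|x x' /set_mem ax /set_mem ax' e|y [ay yE]].
    * exact: code_in_range.
    * by rewrite -(decodeK ax) e decodeK.
    * by exists (decode y).
  + move=> E mE _; apply: measurableI => //.
    by rewrite -[X in measurable X]setTI; exact: measurable_code.
  + move=> E mE ES; rewrite (_ : code @` E = code_range `&` decode @^-1` E).
      apply: measurableI; first exact: measurable_code_range.
      by rewrite -[X in measurable X]setTI; exact: measurable_fun_decode.
    apply/seteqP; split=> y.
      by move=> [x Ex <-]; split; [exact/code_in_range/ES|rewrite /= decodeK //; exact: ES].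
    by move=> [[_ yE] Ey]; exists (decode y).
  move=> E mE _; rewrite /conditional muS setIT probability_setT invr1 mule1.
  by rewrite [RHS]code_lawE setIAC setIid setIC.
by apply: aeW => x; exact: code_orbit.
Qed.

End Isomorphism.

Theorem theorem1p6 (R : realType)
    (mu : probability
            (product_space
               (left_cosets (cyclic_subgroup (@fg_gen 2 ord_max))) 'Z_2) R)
    (mu_product : is_product_measure (uniform_Z2 R) mu) :
  exists (d : measure_display) (L : measurableType d) (lam : probability L R)
         (nu : probability (product_space (free_group 3) L) R)
         (nu_product : is_product_measure lam nu),
    [/\ standard_borel R L, nontrivial_base lam &
        stably_orbit_equivalent
          (coset_shift mu_product) (bernoulli_shift nu_product)].
Proof.
exists default_measure_display, nat, (first_gap_law mu), (code_law mu), (code_law_product mu_product).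
split; [exact: standard_borel_nat|exact: first_gap_law_nontrivial|exact: coset_shift_soe].
Qed.
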